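(* Every matrix algorithm that computes $\left(Z_1+Z_2\overline{Z_1}^{-1}\overline{Z_2}\right)^{-1}$ from complex square matrices $Z_1,Z_2$ uses at least 1 addition and at least 2 inversions, regardless of the number of additions, matrix multiplications, scalar multiplications and conjugations it uses. In particular, the complex Frobenius inversion algorithm is optimal in the sense of the least number of complex matrix inversions: it uses 2 complex matrix inversions to compute $Z^{-1}$ for the quaternion matrix $Z=Z_1+j\overline{Z_2}$, and every matrix algorithm computing $Z^{-1}$ from $Z_1,Z_2$ uses at least 2 complex matrix inversions.
   Context: $\mathbb{H}$ is the real quaternion algebra with units $i,j,k$ ($i^2=j^2=k^2=-1$, $ij=k=-ji$, $jk=i=-kj$, $ki=j=-ik$), and $\mathbb{C}=\mathbb{R}+i\mathbb{R}\subseteq\mathbb{H}$. $\overline{X}$ denotes the entrywise complex conjugate of a complex matrix $X$ (no transpose). For $A,B,C,D\in M_n(\mathbb{R})$ put $Z_1=A+iB$, $Z_2=C+iD$; then $Z=A+iB+jC+kD=Z_1+j\overline{Z_2}$. Matrix algorithm: a finite straight-line program, independent of the matrix size $n$, with inputs $Z_1,Z_2\in M_n(\mathbb{C})$ and with the identity matrix $I_n$ available. Each step applies to previously obtained matrices one of the following operations: addition or subtraction of two matrices (each counted as one addition), multiplication of two matrices, multiplication by a fixed scalar in $\mathbb{C}$, entrywise complex conjugation, or inversion of one matrix in $M_n(\mathbb{C})$ (counted as one inversion). It computes an expression in $Z_1,Z_2$ if, for every $n\geq 1$, for generic $(Z_1,Z_2)\in M_n(\mathbb{C})^2$ (that is,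 outside a proper real algebraic subset) every matrix inverted by the program is invertible and the output equals the value of the expression. It computes $Z^{-1}$ if in this sense it outputs the two complex matrices $P,Q\in M_n(\mathbb{C})$ with $Z^{-1}=P+jQ$. The complex Frobenius inversion algorithm, for an invertible quaternion matrix $Z=A+iB+jC+kD=Z_1+j\overline{Z_2}\in M_n(\mathbb{H})$ with $A,B,C,D\in M_n(\mathbb{R})$, $Z_1=A+iB$ and $Z_2=C+iD$: if $Z_1$ is invertible, compute $X_1=\overline{Z_1}^{-1}$, $X_2=X_1\overline{Z_2}$, $X_3=Z_2X_2$, $X_4=(Z_1+X_3)^{-1}$, $X_5=-X_2X_4$, and return $Z^{-1}=X_4+jX_5$; otherwise, if $Z_2$ is invertible, compute $X_1=\overline{Z_2}^{-1}$, $X_2=X_1\overline{Z_1}$, $X_3=Z_1X_2$, $X_4=(X_3+Z_2)^{-1}$, $X_5=X_2X_4$, and return $Z^{-1}=X_5-jX_4$. *)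

(* Defs.v *)
From HB Require Import structures.
From mathcomp Require Import all_boot all_order all_algebra.
From mathcomp Require Import reals complex mpoly ring.

Set Implicit Arguments.
Unset Strict Implicit.
Unset Printing Implicit Defensive.

Import GRing.Theory.
Local Open Scope ring_scope.

(* ------------------------------------------------------------------------ *)
(* Real quaternions: Quat a b c d stands for a + b i + c j + d k.           *)
(* ------------------------------------------------------------------------ *)

Record quaternion (R : Type) : Type :=
  Quat { quat0 : R; quati : R; quatj : R; quatk : R }.

Section QuaternionChoice.
Variable R : Type.

Definition tuple_of_quat (x : quaternion R) : R * R * R * R :=
  let: Quat a b c d := x in (a, b, c, d).

Definition quat_of_tuple (t : R * R * R * R) : quaternion R :=
  let: (a, b, c, d) := t in Quat a b c d.

Lemma tuple_of_quatK : cancel tuple_of_quat quat_of_tuple.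
Proof. by case. Qed.

End QuaternionChoice.

HB.instance Definition _ (R : eqType) :=
  Equality.copy (quaternion R) (can_type (@tuple_of_quatK R)).
HB.instance Definition _ (R : choiceType) :=
  Choice.copy (quaternion R) (can_type (@tuple_of_quatK R)).

Section QuaternionRing.
Variable R : comNzRingType.
Implicit Types x y z : quaternion R.

Definition addq x y : quaternion R :=
  let: Quat a b c d := x in let: Quat a' b' c' d' := y in
  Quat (a + a') (b + b') (c + c') (d + d').

Definition oppq x : quaternion R :=
  let: Quat a b c d := x in Quat (- a) (- b) (- c) (- d).

Fact addqA : associative addq.
Proof. by case=> ????; case=> ????; case=> ????; rewrite /= !addrA. Qed.
Fact addqC : commutative addq.
Proof. by case=> a b c d; case=> ????; congr Quat; rewrite addrC. Qed.
Fact add0q : left_id (Quat 0 0 0 0) addq.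
Proof. by case=> ????; rewrite /= !add0r. Qed.
Fact addNq : left_inverse (Quat 0 0 0 0) oppq addq.
Proof. by case=> ????; rewrite /= !addNr. Qed.

HB.instance Definition _ :=
  GRing.isZmodule.Build (quaternion R) addqA addqC add0q addNq.

Definition mulq x y : quaternion R :=
  let: Quat a b c d := x in let: Quat a' b' c' d' := y in
  Quat (a * a' - b * b' - c * c' - d * d')
       (a * b' + b * a' + c * d' - d * c')
       (a * c' - b * d' + c * a' + d * b')
       (a * d' + b * c' - c * b' + d * a').

Fact mulqA : associative mulq.
Proof. by case=> ????; case=> ????; case=> ????; congr Quat; ring. Qed.
Fact mul1q : left_id (Quat 1 0 0 0) mulq.
Proof. by case=> ????; congr Quat; ring. Qed.
Fact mulq1 : right_id (Quat 1 0 0 0) mulq.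
Proof. by case=> ????; congr Quat; ring. Qed.
Fact mulqDl : left_distributive mulq addq.
Proof. by case=> ????; case=> ????; case=> ????; congr Quat; ring. Qed.
Fact mulqDr : right_distributive mulq addq.
Proof. by case=> ????; case=> ????; case=> ????; congr Quat; ring. Qed.
Fact oneq_neq0 : Quat 1 0 0 0 != 0 :> quaternion R.
Proof. by apply/eqP=> -[/eqP]; rewrite oner_eq0. Qed.

HB.instance Definition _ := GRing.Zmodule_isNzRing.Build (quaternion R)
  mulqA mul1q mulq1 mulqDl mulqDr oneq_neq0.

Definition qi : quaternion R := Quat 0 1 0 0.
Definition qj : quaternion R := Quat 0 0 1 0.
Definition qk : quaternion R := Quat 0 0 0 1.

Fact quaternion_relations :
  [/\ qi * qi = -1, qj * qj = -1 & qk * qk = -1] /\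
  [/\ qi * qj = qk, qj * qi = - qk, qj * qk = qi & qk * qj = - qi] /\
  (qk * qi = qj /\ qi * qk = - qj).
Proof. by do ![split]; congr Quat; rewrite /=; ring. Qed.

Definition quat_of_real (a : R) : quaternion R := Quat a 0 0 0.

Definition quat_of_complex (z : R[i]) : quaternion R := Quat (Re z) (Im z) 0 0.

Definition conj_mx m n (X : 'M[R[i]]_(m, n)) : 'M[R[i]]_(m, n) :=
  map_mx (@conjc R) X.

(* P + j Q in M_n(H), for complex matrices P and Q. *)
Definition quat_pair n (P Q : 'M[R[i]]_n) : 'M[quaternion R]_n :=
  map_mx quat_of_complex P + qj *: map_mx quat_of_complex Q.

Definition quat_mx n (Z1 Z2 : 'M[R[i]]_n) : 'M[quaternion R]_n :=
  quat_pair Z1 (conj_mx Z2).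

Definition complex_mx n (A B : 'M[R]_n) : 'M[R[i]]_n :=
  \matrix_(i, j) Complex (A i j) (B i j).

Fact quat_mxE n (A B C D : 'M[R]_n) :
  quat_mx (complex_mx A B) (complex_mx C D) =
  map_mx quat_of_real A + qi *: map_mx quat_of_real B
  + qj *: map_mx quat_of_real C + qk *: map_mx quat_of_real D.
Proof. by apply/matrixP=> r s; rewrite !mxE; congr Quat; rewrite /=; ring. Qed.

Fact quat_mx_surj n (Z : 'M[quaternion R]_n) :
  exists Z1 Z2 : 'M[R[i]]_n, Z = quat_mx Z1 Z2.
Proof.
exists (complex_mx (map_mx (@quat0 R) Z) (map_mx (@quati R) Z)).
exists (complex_mx (map_mx (@quatj R) Z) (map_mx (@quatk R) Z)).
rewrite quat_mxE; apply/matrixP=> r s; rewrite !mxE.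
by case: (Z r s) => a b c d; congr Quat; rewrite /=; ring.
Qed.

(* unitmx and invmx need commutative coefficients, hence this relation. *)
Definition is_inverse n (Z W : 'M[quaternion R]_n) : Prop :=
  Z *m W = 1%:M /\ W *m Z = 1%:M.

Definition quat_invertible n (Z : 'M[quaternion R]_n) : Prop :=
  exists W, is_inverse Z W.

End QuaternionRing.

(* ------------------------------------------------------------------------ *)
(* Straight-line programs.  The matrices obtained so far are numbered from  *)
(* 0: the inputs Z1 and Z2 are 0 and 1, the identity is 2, and the t-th     *)
(* step (t = 0, 1, ...) produces number 3 + t.                              *)
(* ------------------------------------------------------------------------ *)

Inductive step (K : Type) : Type :=
  | Add of nat & nat
  | Sub of nat & nat
  | Mul of nat & nat
  | Scale of K & nat
  | Conj of nat
  | Inv of nat.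

Arguments Add {K} _ _.
Arguments Sub {K} _ _.
Arguments Mul {K} _ _.
Arguments Conj {K} _.
Arguments Inv {K} _.

Section Programs.
Variable K : Type.

Definition operands (c : step K) : seq nat :=
  match c with
  | Add p q | Sub p q | Mul p q => [:: p; q]
  | Scale _ p | Conj p | Inv p => [:: p]
  end.

Definition is_addition (c : step K) : bool :=
  match c with Add _ _ | Sub _ _ => true | _ => false end.

Definition is_inversion (c : step K) : bool :=
  if c is Inv _ then true else false.

Fixpoint well_formed (m : nat) (cs : seq (step K)) : bool :=
  if cs is c :: cs' then
    all (fun p => p < m)%N (operands c) && well_formed m.+1 cs'
  else true.

(* The structure does not mention the matrix size. *)
Record algorithm : Type := Algorithm {
  steps : seq (step K);
  outputs : seq nat;
  stepsP : well_formed 3 steps;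
  outputsP : all (fun p => p < 3 + size steps)%N outputs
}.

Definition additions (a : algorithm) : nat := count is_addition (steps a).
Definition inversions (a : algorithm) : nat := count is_inversion (steps a).

End Programs.

Section Semantics.
Variable R : realType.

(* None: the program tries to invert a singular matrix. *)
Definition exec_step n (s : seq 'M[R[i]]_n) (c : step R[i]) :
    option 'M[R[i]]_n :=
  match c with
  | Add p q => Some (s`_p + s`_q)
  | Sub p q => Some (s`_p - s`_q)
  | Mul p q => Some (s`_p *m s`_q)
  | Scale x p => Some (x *: s`_p)
  | Conj p => Some (conj_mx s`_p)
  | Inv p => if s`_p \in unitmx then Some (invmx s`_p) else None
  end.

Fixpoint exec n (s : seq 'M[R[i]]_n) (cs : seq (step R[i])) :
    option (seq 'M[R[i]]_n) :=
  if cs is c :: cs' then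
    if exec_step s c is Some X then exec (rcons s X) cs' else None
  else Some s.

Definition run n (a : algorithm R[i]) (Z1 Z2 : 'M[R[i]]_n) :
    option (seq 'M[R[i]]_n) :=
  omap (fun s => [seq s`_p | p <- outputs a])
       (exec [:: Z1; Z2; 1%:M] (steps a)).

Definition real_coords n (Z1 Z2 : 'M[R[i]]_n) :
    'rV[R]_((n * n + n * n) + (n * n + n * n)) :=
  row_mx
    (row_mx (mxvec (map_mx (@Re R) Z1)) (mxvec (map_mx (@Im R) Z1)))
    (row_mx (mxvec (map_mx (@Re R) Z2)) (mxvec (map_mx (@Im R) Z2))).

Definition real_algebraic n (V : 'M[R[i]]_n -> 'M[R[i]]_n -> Prop) : Prop :=
  exists F : {mpoly R[(n * n + n * n) + (n * n + n * n)]} -> Prop,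
    forall Z1 Z2,
      V Z1 Z2 <-> forall p, F p -> p.@[fun t => real_coords Z1 Z2 0 t] = 0.

Definition generically n (P : 'M[R[i]]_n -> 'M[R[i]]_n -> Prop) : Prop :=
  exists V : 'M[R[i]]_n -> 'M[R[i]]_n -> Prop,
    [/\ real_algebraic V,
        exists Z1 Z2, ~ V Z1 Z2
      & forall Z1 Z2, ~ V Z1 Z2 -> P Z1 Z2].

(* E n Z1 Z2 Ws: the expression is defined at (Z1, Z2) and its value is the
   list Ws of matrices. *)
Definition expression : Type :=
  forall n, 'M[R[i]]_n -> 'M[R[i]]_n -> seq 'M[R[i]]_n -> Prop.

Definition computes (a : algorithm R[i]) (E : expression) : Prop :=
  forall n, (0 < n)%N ->
    generically (fun Z1 Z2 : 'M[R[i]]_n =>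
      exists2 Ws, run a Z1 Z2 = Some Ws & E n Z1 Z2 Ws).

Definition inverse_schur : expression := fun n Z1 Z2 Ws =>
  let S := Z1 + Z2 *m invmx (conj_mx Z1) *m conj_mx Z2 in
  [/\ conj_mx Z1 \in unitmx, S \in unitmx & Ws = [:: invmx S]].

Definition quaternion_inverse : expression := fun n Z1 Z2 Ws =>
  exists P Q, Ws = [:: P; Q] /\ is_inverse (quat_mx Z1 Z2) (quat_pair P Q).

(* The two branches of the complex Frobenius inversion; in both of them X1,
   X2, X3, X4 are numbers 4, 6, 7, 9. *)

Definition frobenius1 : algorithm R[i] := @Algorithm R[i]
  [:: Conj 0; Inv 3;            (* X1 = conj(Z1)^-1 *)
      Conj 1; Mul 4 5;          (* X2 = X1 conj(Z2) *)
      Mul 1 6;                  (* X3 = Z2 X2 *)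
      Add 0 7; Inv 8;           (* X4 = (Z1 + X3)^-1 *)
      Mul 6 9; Scale (-1) 10]   (* X5 = - X2 X4 *)
  [:: 9; 11] isT isT.           (* X4 + j X5 *)

Definition frobenius2 : algorithm R[i] := @Algorithm R[i]
  [:: Conj 1; Inv 3;            (* X1 = conj(Z2)^-1 *)
      Conj 0; Mul 4 5;          (* X2 = X1 conj(Z1) *)
      Mul 0 6;                  (* X3 = Z1 X2 *)
      Add 7 1; Inv 8;           (* X4 = (X3 + Z2)^-1 *)
      Mul 6 9;                  (* X5 = X2 X4 *)
      Scale (-1) 9]
  [:: 10; 11] isT isT.          (* X5 - j X4 *)

Definition frobenius n (Z1 Z2 : 'M[R[i]]_n) : option (algorithm R[i]) :=
  if Z1 \in unitmx then Some frobenius1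
  else if Z2 \in unitmx then Some frobenius2
  else None.

End Semantics.

(* Main.v *)
Require Import Defs.
From mathcomp Require Import all_boot all_order all_algebra.
From mathcomp Require Import boolp reals complex mpoly zify ring.

Set Implicit Arguments.
Unset Strict Implicit.
Unset Printing Implicit Defensive.

Import GRing.Theory Num.Theory.
Local Open Scope ring_scope.

(** Write X, Y, X', Y' for Z1, Z2 and their conjugates, and
    S = X + Y X'^-1 Y'.  Both expressions to be computed contain S^-1: the
    quaternion inverse P + jQ of Z1 + j conj(Z2) satisfies X P - Y Q = 1 and
    X' Q + Y' P = 0, hence S P = 1.

    Two inversions are needed.  A program with a single inversion inverts
    some noncommutative polynomial f in X, Y, X', Y', so its output W is a
    polynomial in these four letters, in f^-1 and in conj(f)^-1.  The point is
    that W stays finite wherever f and conj(f) are invertible, whereas S^-1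
    blows up where S = 0.  So it suffices to find a size n and four
    independent matrices X, Y, X', Y' with X' invertible and S = 0 at which f
    and conj(f) are both invertible (singular_point).  They are taken of the
    form u^-1 diag(a) P with P the cyclic shift matrix: S = 0 is then an entry
    by entry condition, and it is met by letting the entries of diag(a) be
    signed powers z^(e * 4^i), with a digit e < 4 depending on the letter.  A
    word in the letters gives a diagonal matrix times a power of P, with
    diagonal entries that are powers of z, and the exponents of distinct words
    of one length are distinct because they have distinct base 4 expansions.
    Hence the top homogeneous component of f is invertible for generic z, and
    then so is f for generic u (nceval_shift_unit).

    At an actual input X' is the conjugate of X.  The four independent
    matrices are reached by letting Z1 and Z2 be polynomial matrices G(s) in
    one real variable s: the conjugate of G(s) is conj(G)(s), and at the
    non-real point s = i the values G(i) and conj(G)(i) are independent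
    (curve_through).  A curve through one generic point is generic at all but
    finitely many real s (generically_curve), so that the relation S W = 1,
    once denominators are cleared, becomes a polynomial identity in s; its
    value at s = i reads 0 = nonzero (no_single_inversion).

    One addition is needed.  Without additions, for nonzero real t, replacing
    Z2 by t Z2 changes every matrix of a program into t^k times a constant one
    (exec_monomial).  For 1 x 1 matrices S W = 1 then makes
    (|z1|^2 + t^2 |z2|^2) t^k constant in t, which is absurd.

    The positive statements rest on the product formula for P + jQ, and on the
    representation of quaternion matrices by complex matrices of twice the
    size, which turns invertibility into the non-vanishing of a polynomial. *)

(** * Noncommutative polynomials *)

Section NoncommutativePolynomials.
Variables (K : comNzRingType) (L : eqType).

(** A list of coefficients and words.  A word may occur several times: products
    and conjugates are then plain maps over lists, and like terms are only
    collected by [nccoef]. *)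
Definition ncpoly := seq (K * seq L).
Implicit Types (f g : ncpoly) (w : seq L).

Definition word_val n (x : L -> 'M[K]_n) w : 'M[K]_n :=
  foldr (fun l M => x l *m M) 1%:M w.

Definition nceval n (x : L -> 'M[K]_n) f : 'M[K]_n :=
  \sum_(t <- f) t.1 *: word_val x t.2.

Definition nccoef f w : K := \sum_(t <- f | t.2 == w) t.1.

Definition ncscale (c : K) f : ncpoly := [seq (c * t.1, t.2) | t <- f].

Definition ncmul f g : ncpoly :=
  [seq (t.1 * u.1, t.2 ++ u.2) | t <- f, u <- g].

Lemma word_val_cat n (x : L -> 'M[K]_n) w1 w2 :
  word_val x (w1 ++ w2) = word_val x w1 *m word_val x w2.
Proof. by elim: w1 => [|l w IH] /=; rewrite ?mul1mx // IH mulmxA. Qed.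

Lemma eq_word_val n (x y : L -> 'M[K]_n) w :
  x =1 y -> word_val x w = word_val y w.
Proof. by move=> xy; elim: w => //= l w ->; rewrite xy. Qed.

Lemma eq_nceval n (x y : L -> 'M[K]_n) f :
  x =1 y -> nceval x f = nceval y f.
Proof. by move=> xy; apply: eq_bigr => t _; rewrite (eq_word_val _ xy). Qed.

Section Evaluation.
Variables (n : nat) (x : L -> 'M[K]_n).

Lemma nceval_cat f g : nceval x (f ++ g) = nceval x f + nceval x g.
Proof. exact: big_cat. Qed.

Lemma nceval_scale c f : nceval x (ncscale c f) = c *: nceval x f.
Proof.
by rewrite /nceval big_map scaler_sumr; apply: eq_bigr => t _; rewrite scalerA.
Qed.

Lemma nceval_mul f g : nceval x (ncmul f g) = nceval x f *m nceval x g.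
Proof.
rewrite /nceval /ncmul big_allpairs_dep mulmx_suml; apply: eq_bigr => t _.
rewrite mulmx_sumr; apply: eq_bigr => u _.
by rewrite word_val_cat -scalemxAl -scalemxAr scalerA.
Qed.

Lemma nceval_coef f :
  nceval x f = \sum_(w <- undup (unzip2 f)) nccoef f w *: word_val x w.
Proof.
under [RHS]eq_bigr => w _ do rewrite scaler_suml big_mkcond /=.
rewrite exchange_big /=; apply: eq_big_seq => t tf.
under eq_bigr => w _ do rewrite eq_sym.
rewrite -big_mkcond /= -big_filter filter_pred1_uniq ?undup_uniq ?big_seq1 //.
by rewrite mem_undup map_f.
Qed.

(** Multiplying every letter by d multiplies a word of size k by d^k; padding
    with d^(D - k) makes f homogeneous.  This serves both to clear a common
    denominator d of the letters and to isolate the top component of f. *)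
Lemma nceval_homogenize (d : K) (y : L -> 'M[K]_n) D f :
    (forall l, d *: x l = y l) -> all (fun t => size t.2 <= D)%N f ->
  d ^+ D *: nceval x f =
  \sum_(t <- f) (t.1 * d ^+ (D - size t.2)) *: word_val y t.2.
Proof.
move=> dx; have dw w : d ^+ size w *: word_val x w = word_val y w.
  elim: w => [|l w IH] /=; first by rewrite scale1r.
  by rewrite -IH -dx exprS -scalerA -scalemxAl -!scalemxAr.
move=> /allP fD; rewrite scaler_sumr; apply: eq_big_seq => t /fD tD.
by rewrite -dw !scalerA -mulrA -exprD subnK // mulrC.
Qed.

End Evaluation.

Lemma nceval_neq0 n (x : L -> 'M[K]_n) f :
  nceval x f != 0 -> exists w, nccoef f w != 0.
Proof.
rewrite nceval_coef; case: (boolP (has (fun w => nccoef f w != 0)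
                                       (undup (unzip2 f)))).
  by case/hasP=> w _ nz _; exists w.
move/hasPn=> z; rewrite big1_seq ?eqxx // => w /andP[_ /z].
by rewrite negbK => /eqP ->; rewrite scale0r.
Qed.

End NoncommutativePolynomials.

(** * Generic invertible values with vanishing Schur complement *)

Lemma base4_inj m (D D' : 'I_m -> nat) :
    (forall j, D j < 4)%N -> (forall j, D' j < 4)%N ->
  (\sum_(j < m) D j * 4 ^ j = \sum_(j < m) D' j * 4 ^ j)%N -> D =1 D'.
Proof.
elim: m => [|m IH] in D D' * => ltD ltD' eqDD'; first by case.
have split (F : 'I_m.+1 -> nat) : (\sum_(j < m.+1) F j * 4 ^ j =
    F ord0 + 4 * \sum_(j < m) F (lift ord0 j) * 4 ^ j)%N.
  rewrite big_ord_recl muln1 big_distrr; congr (_ + _)%N.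
  by apply: eq_bigr => j _; rewrite lift0 expnS mulnCA.
move: eqDD'; rewrite !split => eqDD'.
have {}IH := IH (fun j => D (lift ord0 j)) (fun j => D' (lift ord0 j)).
have lt0 := ltD ord0; have lt0' := ltD' ord0.
move=> j; case: (unliftP ord0 j) => [k ->|->]; last by lia.
by apply: IH; [move=> ? | move=> ? |]; rewrite ?ltD ?ltD' //; lia.
Qed.

(** The letter (v, c) stands for Z1 or Z2 according to v, conjugated when c
    holds. *)
Definition letter := (bool * bool)%type.

(** The digits are distinct, so that a word can be read off the exponent in
    base 4, and digit Z1 = digit Z2 + digit conj(Z2) with digit conj(Z1) = 0, so
    that together with the sign below the Schur complement of the four shift
    matrices vanishes. *)
Definition digit (l : letter) : nat :=
  match l with
  | (false, false) => 3 | (true, false) => 2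
  | (false, true) => 0 | (true, true) => 1
  end.

Lemma digit_inj : injective digit. Proof. by do 2!case=> -[] []. Qed.
Lemma digit_lt4 l : (digit l < 4)%N. Proof. by case: l => -[] []. Qed.

Section ShiftMatrices.
Variables (K : fieldType) (n : nat).

Definition letter_sign (l : letter) : K := if l.1 && l.2 then -1 else 1.

Definition shift_mx (z : K) (l : letter) : 'M[K]_n.+2 :=
  \matrix_(i, j)
    if j == i + 1 then letter_sign l * z ^+ (digit l * 4 ^ i) else 0.

Fixpoint word_exp (w : seq letter) (i : 'I_n.+2) : nat :=
  if w is l :: w' then (digit l * 4 ^ i + word_exp w' (i + 1)%R)%N else 0%N.

Definition word_sign (w : seq letter) : K := \prod_(l <- w) letter_sign l.

Lemma word_sign_neq0 w : word_sign w != 0.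
Proof.
rewrite prodf_seq_neq0; apply/allP => l _ /=.
by rewrite /letter_sign; case: ifP; rewrite ?oppr_eq0 oner_eq0.
Qed.

(** Multiplying by a shift matrix moves the rest of the word one step along the
    cycle, so that each of its letters is read at its own power of 4. *)
Lemma word_val_shift z w :
  word_val (shift_mx z) w =
  \matrix_(i, j)
    if j == i + (size w)%:R then word_sign w * z ^+ word_exp w i else 0.
Proof.
elim: w => [|l w IH] /=.
  apply/matrixP=> i j; rewrite !mxE addr0 eq_sym /word_sign big_nil mulr1.
  by case: eqP.
rewrite IH; apply/matrixP=> i j; rewrite !mxE (bigD1 (i + 1)) //= big1 ?addr0.
  rewrite !mxE eqxx -addrA -mulrS; case: ifP => _; last by rewrite mulr0.
  by rewrite /word_sign big_cons exprD; ring.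
by move=> k /negPf k1; rewrite !mxE k1 mul0r.
Qed.

(** For a word no longer than the cycle, the digit in position j is the one of
    the letter with index j - i, counted cyclically. *)
Lemma word_expE w (i : 'I_n.+2) : (size w <= n.+2)%N ->
  word_exp w i =
  (\sum_(j < n.+2) (if (j - i)%R < size w
                     then digit (nth (false, false) w (j - i)%R)
                     else 0) * 4 ^ j)%N.
Proof.
move=> sw; rewrite (reindex_inj (addrI i)).
under eq_bigr => k _ do rewrite [(i + k - i)%R]addrC addKr.
have -> : word_exp w i = (\sum_(k < size w)
     digit (nth (false, false) w k) * 4 ^ (i + k%:R)%R)%N.
  elim: w i {sw} => [|l w IH] i; first by rewrite big_ord0.
  rewrite [LHS](_ : _ = digit l * 4 ^ i + word_exp w (i + 1)%R)%N // IH.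
  rewrite [RHS](big_ord_recl (size w)) addr0; congr (_ + _)%N.
  by apply: eq_bigr => k _; rewrite -addrA -mulrS.
rewrite (big_ord_widen _ (fun k =>
  (digit (nth (false, false) w k) * 4 ^ (i + k%:R)%R)%N) sw) big_mkcond.
apply: eq_bigr => k _; rewrite [in LHS]natr_Zp addrC; by case: ifP.
Qed.

Lemma word_exp_inj w w' (i : 'I_n.+2) :
    size w = size w' -> (size w <= n.+2)%N ->
  word_exp w i = word_exp w' i -> w = w'.
Proof.
move=> eqs sw; have sw' := sw; rewrite eqs in sw'.
rewrite !word_expE // => /base4_inj eqD.
apply: (@eq_from_nth _ (false, false)) => // k kw.
have kn : (k < n.+2)%N := leq_trans kw sw.
have := eqD _ _ (i + Ordinal kn); rewrite [(_ - i)%R]addrC addKr /=.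
rewrite -eqs kw => H; apply: digit_inj; apply: H => j.
  by case: ifP => // _; rewrite digit_lt4.
by case: ifP => // _; rewrite digit_lt4.
Qed.

End ShiftMatrices.

Definition ncreduce (K : comNzRingType) (L : eqType) (f : ncpoly K L) :=
  [seq (nccoef f w, w) | w <- undup (unzip2 f) & nccoef f w != 0].

Lemma nceval_reduce (K : comNzRingType) (L : eqType) n (x : L -> 'M[K]_n) f :
  nceval x (ncreduce f) = nceval x f.
Proof.
rewrite [RHS]nceval_coef /nceval big_map big_filter /=.
rewrite [RHS](bigID (fun w => nccoef f w != 0)) /=.
rewrite [X in _ = _ + X]big1 ?addr0 // => w.
by rewrite negbK => /eqP ->; rewrite scale0r.
Qed.

Lemma mem_ncreduce (K : comNzRingType) (L : eqType) (f : ncpoly K L) t :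
  (t \in ncreduce f) = (t.1 == nccoef f t.2) && (t.1 != 0).
Proof.
case: t => c w /=; apply/mapP/andP => [[v] | [/eqP -> nz]].
  by rewrite mem_filter => /andP[nz _] [-> ->].
exists w; rewrite // mem_filter nz mem_undup; apply: contraR nz => wf.
rewrite /nccoef big1_seq // => t /andP[/eqP tw tf].
by case/negP: wf; rewrite -tw map_f.
Qed.

Lemma uniq_ncreduce (K : comNzRingType) (L : eqType) (f : ncpoly K L) :
  uniq (ncreduce f).
Proof.
by rewrite map_inj_uniq ?filter_uniq ?undup_uniq // => v w [].
Qed.

Lemma all_size_max (T : eqType) (h : T -> nat) (s : seq T) x0 : x0 \in s ->
  exists2 t, t \in s & all (fun u => h u <= h t)%N s.
Proof.
elim: s x0 => // x s IH x0 _; case: s IH => [_|y s IH].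
  by exists x; rewrite ?mem_head //= leqnn.
have [t ts /allP tmax] := IH y (mem_head _ _).
case: (leqP (h x) (h t)) => [xt | /ltnW tx].
  exists t; first by rewrite in_cons ts orbT.
  by apply/allP => u; rewrite in_cons => /predU1P[-> //|]; apply: tmax.
exists x; first exact: mem_head.
apply/allP => u; rewrite in_cons => /predU1P[-> //|/tmax ut].
exact: leq_trans ut tx.
Qed.

(** The top component of f, of degree D, takes the value diag(g) P^D, where P
    is the cyclic shift and each g_i is a nonzero polynomial in z, by
    [word_exp_inj].  For z outside the roots of the g_i it is invertible, and it
    is the value at u = 0 of the matrix u^D f(u^-1 x), whose determinant is
    therefore a nonzero polynomial in u. *)
Lemma nceval_shift_unit (K : fieldType) n (f : ncpoly K letter) w0 :
    nccoef f w0 != 0 -> all (fun t => size t.2 <= n.+2)%N f ->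
  exists2 b : {poly K}, b != 0 & forall z, b.[z] != 0 ->
    exists2 b' : {poly K}, b' != 0 & forall u, u != 0 -> b'.[u] != 0 ->
      nceval (fun l => u^-1 *: shift_mx n z l) f \in unitmx.
Proof.
move=> nz szf; have f0 : (nccoef f w0, w0) \in ncreduce f.
  by rewrite mem_ncreduce eqxx.
have [[c1 w1] t1f /= topw] := all_size_max (fun t => size t.2) f0.
set D := size w1 in topw; set r := ncreduce f in t1f topw.
have Dn : (D <= n.+2)%N.
  move: t1f; rewrite mem_ncreduce /= => /andP[/eqP -> c1nz].
  have [u uf] : exists2 u, u \in f & u.2 == w1.
    apply/hasP; apply: contraR c1nz => /hasPn no.
    by rewrite /nccoef big1_seq // => t /andP[tw /no]; rewrite tw.
  by move/eqP=> uw; rewrite /D -uw (allP szf).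
(* The diagonal entries g_i of the top component, as polynomials in z. *)
pose G (i : 'I_n.+2) : {poly K} :=
  \sum_(t <- r | size t.2 == D) (t.1 * word_sign K t.2) *: 'X^(word_exp t.2 i).
have Gnz i : G i != 0.
  apply/eqP=> /(congr1 (fun p : {poly K} => p`_(word_exp w1 i))).
  rewrite coef0 coef_sum -big_filter (bigD1_seq (c1, w1));
    rewrite ?filter_uniq ?uniq_ncreduce ?mem_filter ?eqxx //=.
  rewrite coefZ coefXn eqxx mulr1 big1_seq ?addr0.
    move/eqP; rewrite mulf_eq0 (negPf (word_sign_neq0 _ _)) orbF.
    by move: t1f; rewrite mem_ncreduce => /andP[_ /negPf ->].
  move=> [c w] /andP[neq]; rewrite mem_filter => /= /andP[/eqP sw tr].
  rewrite coefZ coefXn; case: eqP => [e|_]; last by rewrite mulr0.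
  case/negP: neq; apply/eqP.
  have ew : w = w1 by apply: (@word_exp_inj n _ _ i); rewrite ?sw.
  move: t1f tr; rewrite !mem_ncreduce /= ew => /andP[/eqP -> _].
  by case/andP=> /eqP ->.
exists (\prod_i G i) => [|z]; first by apply/prodf_neq0.
rewrite horner_prod => /prodf_neq0 Gz.
(* u^D f(u^-1 x) as a polynomial matrix in u. *)
pose B : 'M[{poly K}]_n.+2 := \sum_(t <- r)
  (t.1 *: 'X^(D - size t.2)) *: map_mx polyC (word_val (shift_mx n z) t.2).
have evB u : map_mx (horner_eval u) B =
    \sum_(t <- r) (t.1 * u ^+ (D - size t.2)) *: word_val (shift_mx n z) t.2.
  rewrite raddf_sum; apply: eq_bigr => t _ /=.
  rewrite map_mxZ /= horner_evalE !hornerE -map_mx_comp.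
  by congr (_ *: _); apply/matrixP=> i j; rewrite !mxE /= horner_evalE hornerC.
have detB u : (\det B).[u] = \det (map_mx (horner_eval u) B).
  by rewrite det_map_mx.
exists (\det B) => [|u u0].
  apply/eqP=> B0; have := detB 0; rewrite B0 horner0.
  apply/eqP; rewrite eq_sym -unitfE -unitmxE.
  pose U : 'M[K]_n.+2 := \matrix_(j, i)
    if j == i + D%:R then (G i).[z]^-1 else 0.
  suff: map_mx (horner_eval 0) B *m U = 1%:M by case/mulmx1_unit.
  have -> : map_mx (horner_eval 0) B =
      \matrix_(i, j) if j == i + D%:R then (G i).[z] else 0.
    rewrite evB (bigID (fun t => size t.2 == D)) /=.
    rewrite [X in _ + X]big1_seq ?addr0 => [|t /andP[sD /(allP topw) st]].
      apply/matrixP=> i j; rewrite summxE mxE /G horner_sum.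
      case: ifP => ij.
        apply: eq_bigr => t /eqP st; rewrite word_val_shift !mxE st ij subnn.
        by rewrite hornerZ hornerXn expr0 mulr1 mulrA.
      rewrite big1 // => t /eqP st.
      by rewrite word_val_shift !mxE st ij mulr0.
    rewrite expr0n subn_eq0 leqNgt ltn_neqAle sD st /=.
    by rewrite mulr0 scale0r.
  apply/matrixP=> i k; rewrite !mxE (bigD1 (i + D%:R)) //= big1 => [|j].
    rewrite !mxE eqxx (inj_eq (addIr _)) addr0 eq_sym; case: eqP => [->|_].
      by rewrite mulfV ?Gz.
    by rewrite mulr0.
  by move=> /negPf ij; rewrite !mxE ij mul0r.
rewrite detB -unitfE -unitmxE evB => unitB.
have := @nceval_homogenize _ _ _ (fun l => u^-1 *: shift_mx n z l) u
  (shift_mx n z) D r _ topw.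
rewrite -/r nceval_reduce => H.
rewrite -(unitmxZ _ (_ : u ^+ D \is a GRing.unit)) ?unitfE ?expf_neq0 //.
by rewrite H // => l; rewrite scalerA mulfV // scale1r.
Qed.

(** * Polynomial curves of matrices *)

Section Curves.
Variable R : realType.
Local Notation C := R[i].
Local Notation I := (Complex 0 1 : C).
Implicit Types (p b : {poly C}).

Lemma poly_nonroot (K : numFieldType) (p : {poly K}) :
  p != 0 -> exists n : nat, p.[n%:R] != 0.
Proof.
move=> p0; pose rs := [seq (i%:R : K) | i <- iota 0 (size p)].
case: (boolP (all (root p) rs)) => [rootp | /allPn[_ /mapP[n _ ->] nr]].
  have := @roots_geq_poly_eq0 _ p rs rootp.
  rewrite map_inj_uniq ?iota_uniq; last first.
    by move=> i j /eqP; rewrite eqr_nat => /eqP.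
  by rewrite size_map size_iota => /(_ isT (leqnn _)) /eqP; rewrite (negPf p0).
by exists n.
Qed.

Lemma realC_nat n : (n%:R : R)%:C%C = n%:R :> C.
Proof. by rewrite rmorph_nat. Qed.

Lemma poly_identity p b : b != 0 ->
  (forall s : R, b.[s%:C%C] != 0 -> p.[s%:C%C] = 0) -> p = 0.
Proof.
move=> b0 pb; apply/eqP; apply: contraT => p0.
have [|n] := @poly_nonroot _ (p * b); first by rewrite mulf_neq0.
rewrite hornerM mulf_eq0 negb_or -realC_nat => /andP[pn bn].
by rewrite pb ?eqxx in pn.
Qed.

Definition mxeval n (z : C) (G : 'M[{poly C}]_n) : 'M[C]_n :=
  map_mx (horner_eval z) G.

(** The conjugate of p(s) for real s, as a polynomial in s. *)
Definition conj_poly p : {poly C} := map_poly (@conjc R) p.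

Lemma horner_conj_poly p z : (conj_poly p).[z] = conjc p.[conjc z].
Proof. by rewrite -{1}[z]conjcK horner_map. Qed.

Lemma mxeval_conj n (G : 'M[{poly C}]_n) z :
  mxeval z (map_mx conj_poly G) = conj_mx (mxeval (conjc z) G).
Proof.
by apply/matrixP=> i j; rewrite !mxE /horner_eval horner_conj_poly.
Qed.

Lemma real_curve_coord p : exists q : {poly R} * {poly R}, forall s : R,
  complex.Re p.[s%:C%C] = q.1.[s] /\ complex.Im p.[s%:C%C] = q.2.[s].
Proof.
elim/poly_ind: p => [|p c [[q1 q2] IH]].
  by exists (0, 0) => s /=; rewrite !horner0.
exists (q1 * 'X + (complex.Re c)%:P, q2 * 'X + (complex.Im c)%:P) => s /=.
have [/= e1 e2] := IH s; rewrite !hornerMXaddC -e1 -e2.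
by case: (p.[_]) c => u v [c1 c2] /=; split; ring.
Qed.

Lemma real_coords_curve n (G1 G2 : 'M[{poly C}]_n) t :
  exists q : {poly R}, forall s : R,
    real_coords (mxeval s%:C%C G1) (mxeval s%:C%C G2) 0 t = q.[s].
Proof.
have coord (G : 'M[{poly C}]_n) u : (exists q : {poly R}, forall s : R,
    mxvec (map_mx (@complex.Re R) (mxeval s%:C%C G)) 0 u = q.[s]) /\
  (exists q : {poly R}, forall s : R,
    mxvec (map_mx (@complex.Im R) (mxeval s%:C%C G)) 0 u = q.[s]).
  case/mxvec_indexP: u => i j; have [[q1 q2] q12] := real_curve_coord (G i j).
  split; [exists q1 | exists q2] => s; rewrite mxvecE !mxE /=;
    by have [] := q12 s.
rewrite /real_coords; case: (split_ordP t) => t' ->; last first.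
  case: (split_ordP t') => u ->.
    have [q hq] := (coord G2 u).1.
    by exists q => s; rewrite row_mxEr row_mxEl hq.
  have [q hq] := (coord G2 u).2.
  by exists q => s; rewrite row_mxEr row_mxEr hq.
case: (split_ordP t') => u ->.
  have [q hq] := (coord G1 u).1.
  by exists q => s; rewrite !row_mxEl hq.
have [q hq] := (coord G1 u).2.
by exists q => s; rewrite row_mxEl row_mxEr hq.
Qed.

(** Along a curve, a polynomial that does not vanish at G(s0) is a nonzero
    polynomial in s, so it vanishes for finitely many s only. *)
Lemma generically_curve n (P : 'M[C]_n -> 'M[C]_n -> Prop) : generically P ->
  exists U : 'M[C]_n -> 'M[C]_n -> Prop,
  [/\ exists Z1 Z2, U Z1 Z2,
      forall Z1 Z2, U Z1 Z2 -> P Z1 Z2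
    & forall (G1 G2 : 'M[{poly C}]_n) (s0 : R),
      U (mxeval s0%:C%C G1) (mxeval s0%:C%C G2) ->
      exists2 b : {poly C}, b != 0 & forall s : R, b.[s%:C%C] != 0 ->
        U (mxeval s%:C%C G1) (mxeval s%:C%C G2)].
Proof.
case=> V [[F VF] [Z1 [Z2 nV]] VP]; exists (fun Z1 Z2 => ~ V Z1 Z2).
split=> // [|G1 G2 s0]; first by exists Z1, Z2.
rewrite VF => /existsNP[p] /not_implyP[Fp /eqP pnz].
have [q hq] := boolp.choice (real_coords_curve G1 G2).
pose r := \sum_(m <- msupp p) p@_m *: \prod_t q t ^+ m t.
have rE s : r.[s] =
    p.@[fun t => real_coords (mxeval s%:C%C G1) (mxeval s%:C%C G2) 0 t].
  rewrite mevalE horner_sum; apply: eq_bigr => m _.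
  rewrite hornerZ horner_prod; congr (_ * _); apply: eq_bigr => t _.
  by rewrite horner_exp hq.
have bE s : (map_poly (real_complex R) r).[s%:C%C] = (r.[s])%:C%C.
  exact: horner_map.
exists (map_poly (real_complex R) r) => [|s].
  apply: contraNneq pnz => r0; rewrite -rE; apply/eqP/(@complexI R).
  by rewrite -bE r0 horner0.
rewrite bE rE => nz VG; case/eqP: nz; congr (_%:C%C).
by move/VF: VG; apply.
Qed.

(** Lagrange interpolation at 0, i and -i.  The value at -i is the conjugate of
    the value at i of the conjugate curve: a curve and its conjugate can thus be
    given independent values at i. *)
Lemma curve_through n (G A B : 'M[C]_n) : exists Gam : 'M[{poly C}]_n,
  [/\ mxeval 0 Gam = G, mxeval I Gam = A & mxeval (- I) Gam = B].
Proof.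
pose cst := map_mx (@polyC C).
have cstE z (M : 'M[C]_n) p : mxeval z (p *: cst _ _ M) = p.[z] *: M.
  by apply/matrixP=> i j; rewrite !mxE /horner_eval !hornerE.
have : I * I = -1 by rewrite -expr2 sqr_i.
move: I => i0 I2.
exists (('X * 'X + 1) *: cst _ _ G
   + (- 2^-1 *: ('X * ('X + i0%:P))) *: cst _ _ A
   + (- 2^-1 *: ('X * ('X - i0%:P))) *: cst _ _ B).
have evD z (M N : 'M_n) : mxeval z (M + N) = mxeval z M + mxeval z N.
  exact: raddfD.
have val z : mxeval z (('X * 'X + 1) *: cst _ _ G
      + (- 2^-1 *: ('X * ('X + i0%:P))) *: cst _ _ A
      + (- 2^-1 *: ('X * ('X - i0%:P))) *: cst _ _ B) =
    (z * z + 1) *: G + (- 2^-1 * (z * (z + i0))) *: A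
      + (- 2^-1 * (z * (z - i0))) *: B.
  by rewrite !evD !cstE !hornerE.
have e1 : i0 * i0 + 1 = 0 by rewrite I2 addNr.
have e2 : - 2^-1 * (i0 * (i0 + i0)) = 1.
  rewrite (_ : _ * _ = - (i0 * i0)); last by field.
  by rewrite I2 opprK.
rewrite !val; split.
- by rewrite !mul0r !mulr0 add0r !scale0r !addr0 scale1r.
- by rewrite e1 e2 subrr !mulr0 !scale0r scale1r add0r addr0.
- rewrite mulrNN e1 addNr -opprD mulrNN e2 !mulr0 !scale0r scale1r.
  by rewrite !add0r.
Qed.

Section Evaluation.
Variables (n : nat) (z : C).

Lemma mxevalM (G H : 'M[{poly C}]_n) :
  mxeval z (G *m H) = mxeval z G *m mxeval z H.
Proof. exact: map_mxM. Qed.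

Lemma mxevalZ p (G : 'M[{poly C}]_n) : mxeval z (p *: G) = p.[z] *: mxeval z G.
Proof. exact: map_mxZ. Qed.

Lemma mxeval_det (G : 'M[{poly C}]_n) : (\det G).[z] = \det (mxeval z G).
Proof. by rewrite det_map_mx. Qed.

Lemma mxeval_adj (G : 'M[{poly C}]_n) :
  mxeval z (\adj G) = \adj (mxeval z G).
Proof. exact: map_mx_adj. Qed.

Lemma mxeval_scalar p : mxeval z (p%:M : 'M_n) = p.[z]%:M.
Proof. exact: map_scalar_mx. Qed.

Lemma mxevalD (G H : 'M[{poly C}]_n) :
  mxeval z (G + H) = mxeval z G + mxeval z H.
Proof. exact: raddfD. Qed.

Lemma mxeval_word (L : eqType) (y : L -> 'M[{poly C}]_n) w :
  mxeval z (word_val y w) = word_val (fun l => mxeval z (y l)) w.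
Proof.
by elim: w => [|l w IH] /=; rewrite ?mxeval_scalar ?hornerE // mxevalM IH.
Qed.

Lemma mxeval_sum (T : eqType) (f : seq T) (F : T -> 'M[{poly C}]_n) :
  mxeval z (\sum_(t <- f) F t) = \sum_(t <- f) mxeval z (F t).
Proof. exact: raddf_sum. Qed.

End Evaluation.

End Curves.

(** * Noncommutative polynomials in variables and their conjugates *)

Section Stars.
Variable R : realType.
Local Notation C := R[i].
Local Notation I := (Complex 0 1 : C).

Definition flip (T : Type) (l : T * bool) : T * bool := (l.1, ~~ l.2).

Definition star n (T : Type) (z : T -> 'M[C]_n) (l : T * bool) : 'M[C]_n :=
  if l.2 then conj_mx (z l.1) else z l.1.

Definition ncconj (T : eqType) (f : ncpoly C (T * bool)%type) :
    ncpoly C (T * bool)%type :=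
  [seq (conjc t.1, map (@flip T) t.2) | t <- f].

Lemma flipK (T : Type) : involutive (@flip T).
Proof. by case=> t b; rewrite /flip negbK. Qed.

Lemma conj_mxK n (A : 'M[C]_n) : conj_mx (conj_mx A) = A.
Proof. by apply/matrixP=> i j; rewrite !mxE conjcK. Qed.

Lemma star_flip n (T : Type) (z : T -> 'M[C]_n) l :
  star z (flip l) = conj_mx (star z l).
Proof. by case: l => t []; rewrite /star /= ?conj_mxK. Qed.

Lemma nceval_conj n (T : eqType) (x y : (T * bool)%type -> 'M[C]_n) f :
    (forall l, y (flip l) = conj_mx (x l)) ->
  nceval y (ncconj f) = conj_mx (nceval x f).
Proof.
move=> yx; rewrite /nceval big_map /conj_mx raddf_sum; apply: eq_bigr => t _.
rewrite /= map_mxZ; congr (_ *: _); elim: t.2 => [|l w IH] /=.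
  by rewrite map_mx1.
by rewrite map_mxM IH yx.
Qed.

Lemma nccoef_conj (T : eqType) (f : ncpoly C (T * bool)%type) w :
  nccoef (ncconj f) (map (@flip T) w) = conjc (nccoef f w).
Proof.
rewrite /nccoef big_map rmorph_sum; apply: eq_bigl => t.
by rewrite (inj_eq (inj_map (can_inj (@flipK T)))).
Qed.

Lemma shift_mx_unit (K : fieldType) n (z : K) :
  shift_mx n z (false, true) \in unitmx.
Proof.
set P := shift_mx _ _ _; suff: P *m P^T = 1%:M by case/mulmx1_unit.
apply/matrixP=> i k; rewrite !mxE (bigD1 (i + 1)) //= big1 => [|j].
  rewrite !mxE eqxx (inj_eq (addIr _)) addr0 /letter_sign /=.
  by rewrite !mul1r; case: eqP.
by move=> /negPf ij; rewrite !mxE ij mul0r.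
Qed.

(** Write x l = diag(e_l) x(conj Z1).  The claim becomes
    e_(Z1) + e_(Z2) e_(conj Z2) = 0: digits and signs were chosen for this. *)
Lemma shift_mx_schur (K : fieldType) n (z : K) (x := shift_mx n z) :
  x (false, false)
  + x (true, false) *m invmx (x (false, true)) *m x (true, true) = 0.
Proof.
pose e l : 'M[K]_n.+2 :=
  diag_mx (\row_i (letter_sign K l * z ^+ (digit l * 4 ^ i))).
have xE l : x l = e l *m x (false, true).
  apply/matrixP=> i j; rewrite mul_diag_mx !mxE.
  have -> :
      letter_sign K (false, true) * z ^+ (digit (false, true) * 4 ^ i) = 1.
    exact: mul1r.
  by case: eqP => _; rewrite ?mulr0 ?mulr1.
rewrite xE (xE (true, false)) mulmxK ?shift_mx_unit // (xE (true, true)).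
rewrite mulmxA -mulmxDl mulmx_diag -raddfD /=.
rewrite [X in diag_mx X](_ : _ = 0) ?raddf0 ?mul0mx //.
apply/matrixP=> i j; rewrite !mxE /letter_sign /= !mul1r mulN1r mulrN -exprD.
by rewrite -mulnDl subrr.
Qed.

(** A point where the inverse of the Schur complement has a pole, while the
    inverses of f and of its conjugate are regular.  The four matrices x l are
    independent: x (v, true) need not be the conjugate of x (v, false). *)
Lemma singular_point (f : ncpoly C letter) w0 : nccoef f w0 != 0 ->
  exists n (x : letter -> 'M[C]_n.+1),
  [/\ nceval x f \in unitmx, nceval x (ncconj f) \in unitmx,
      x (false, true) \in unitmx
    & x (false, false)
      + x (true, false) *m invmx (x (false, true)) *m x (true, true) = 0].
Proof.
move=> nz; pose n := (\max_(t <- f) size t.2)%N.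
have szf : all (fun t => size t.2 <= n.+2)%N f.
  apply/allP => t tf; rewrite !leqW // /n (big_rem _ tf) /=.
  exact: leq_maxl.
have szf' : all (fun t => size t.2 <= n.+2)%N (ncconj f).
  rewrite all_map; apply: sub_all szf => t /=; by rewrite size_map.
have [b b0 hb] := nceval_shift_unit nz szf.
have [|b' b'0 hb'] := nceval_shift_unit (w0 := map (@flip _) w0) _ szf'.
  by rewrite nccoef_conj conjc_eq0.
have [|k] := @poly_nonroot _ (b * b'); first by rewrite mulf_neq0.
rewrite hornerM mulf_eq0 negb_or => /andP[/hb[c c0 hc] /hb'[c' c'0 hc']].
have [|m] := @poly_nonroot _ ('X * (c * c')).
  by rewrite !mulf_neq0 ?polyX_eq0.
rewrite !hornerM hornerX !mulf_eq0 !negb_or => /and3P[m0 cm c'm].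
set u : C := m%:R; set z : C := k%:R.
exists n.+1, (fun l => u^-1 *: shift_mx n z l); split.
- exact: hc.
- exact: hc'.
- by rewrite unitmxZ ?shift_mx_unit // unitfE invr_eq0.
- rewrite invmxZ ?unitmxZ ?shift_mx_unit ?unitfE ?invr_eq0 // invrK.
  rewrite -!scalemxAr -!scalemxAl !scalerA mulVf // mul1r -scalerDr.
  by rewrite shift_mx_schur scaler0.
Qed.

End Stars.

(** * A single inversion does not suffice *)

Section Core.
Variable R : realType.
Local Notation C := R[i].
Local Notation I := (Complex 0 1 : C).

Definition input_pair n (Z1 Z2 : 'M[C]_n) (b : bool) : 'M[C]_n :=
  if b then Z2 else Z1.

(** The variable None stands for the one inverse that is computed. *)
Definition adjoin n (z : bool -> 'M[C]_n) (U : 'M[C]_n) (o : option bool) :=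
  if o is Some b then z b else U.

Lemma conj_mx_unit n (A : 'M[C]_n) : (conj_mx A \in unitmx) = (A \in unitmx).
Proof. exact: map_unitmx. Qed.

Lemma conj_mxZ n c (A : 'M[C]_n) : conj_mx (c *: A) = conjc c *: conj_mx A.
Proof. exact: map_mxZ. Qed.

Lemma conjc_realC (s : R) : conjc (s%:C)%C = (s%:C)%C.
Proof. exact: conjc_real. Qed.

Lemma mxeval_nceval (L : eqType) n (y : L -> 'M[{poly C}]_n)
    (f : ncpoly C L) z :
  mxeval z (\sum_(t <- f) t.1%:P *: word_val y t.2) =
  nceval (fun l => mxeval z (y l)) f.
Proof.
rewrite mxeval_sum; apply: eq_bigr => t _.
by rewrite mxevalZ hornerC mxeval_word.
Qed.

Definition schur n (Z1 Z2 : 'M[C]_n) : 'M[C]_n :=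
  Z1 + Z2 *m invmx (conj_mx Z1) *m conj_mx Z2.

(** Along a curve with the values of [singular_point] at s = i, the output g
    has the form N(s) / d(s)^D with d(i) nonzero.  Clearing all denominators in
    S g = 1 gives H N = det(X') d^D with H = det(X') S, a polynomial identity in
    s as it holds for all but finitely many real s.  At s = i the left side
    vanishes and the right side does not. *)
Lemma no_single_inversion (f : ncpoly C letter)
    (g : ncpoly C (option bool * bool)%type) :
  ~ (forall n, (0 < n)%N -> generically (fun Z1 Z2 : 'M[C]_n =>
       let F := nceval (star (input_pair Z1 Z2)) f in
       F \in unitmx /\ (conj_mx Z1 \in unitmx ->
         schur Z1 Z2 *m
         nceval (star (adjoin (input_pair Z1 Z2) (invmx F))) g = 1%:M))).
Proof.
move=> gen; have [w0 nz] : exists w, nccoef f w != 0.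
  have [V [_ [Z1 [Z2 nV]] VP]] := gen 1%N isT.
  have [Fu _] := VP _ _ nV.
  apply: (@nceval_neq0 _ _ 1%N (star (input_pair Z1 Z2))).
  by apply: contraTneq Fu => ->; rewrite unitmxE det0 unitr0.
have [n [x [fx f'x x'u xsing]]] := singular_point nz.
have [U [[Z1 [Z2 UZ]] UP Ucurve]] := generically_curve (gen n.+1 isT).
have [Gam hGam] : exists Gam : bool -> 'M[{poly C}]_n.+1, forall b,
  [/\ mxeval 0 (Gam b) = input_pair Z1 Z2 b, mxeval I (Gam b) = x (b, false)
    & mxeval (- I) (Gam b) = conj_mx (x (b, true))].
  have thr b := curve_through (input_pair Z1 Z2 b) (x (b, false))
                              (conj_mx (x (b, true))).
  by have [Gam hGam] := boolp.choice thr; exists Gam.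
have [|b b0 Ub] := Ucurve (Gam false) (Gam true) 0.
  by have [-> _ _] := hGam false; have [-> _ _] := hGam true.
pose y (l : letter) := if l.2 then map_mx (@conj_poly R) (Gam l.1) else Gam l.1.
have conjI : conjc I = - I by apply/eqP; rewrite eq_complex /= oppr0 !eqxx.
have conjNI : conjc (- I) = I by rewrite -conjI conjcK.
have yI l : mxeval I (y l) = x l.
  case: l => v []; rewrite /y /=; last by have [] := hGam v.
  by rewrite mxeval_conj conjI; have [_ _ ->] := hGam v; rewrite conj_mxK.
have yNI l : mxeval (- I) (y (flip l)) = conj_mx (x l).
  case: l => v []; rewrite /y /=; first by have [] := hGam v.
  by rewrite mxeval_conj conjNI; have [_ -> _] := hGam v.
have yR (s : R) l : mxeval s%:C%C (y l) =
    star (input_pair (mxeval s%:C%C (Gam false)) (mxeval s%:C%C (Gam true))) l.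
  case: l => [v []]; rewrite /y /star /= ?mxeval_conj ?conjc_realC; by case: v.
(* f along the curve: it is invertible at i and at -i. *)
pose M := \sum_(t <- f) t.1%:P *: word_val y t.2.
have ME z : mxeval z M = nceval (fun l => mxeval z (y l)) f.
  exact: mxeval_nceval.
pose de := \det M.
have deI : de.[I] != 0.
  by rewrite mxeval_det ME (eq_nceval _ yI) -unitfE -unitmxE.
have deNI : de.[- I] != 0.
  rewrite mxeval_det ME -unitfE -unitmxE -conj_mx_unit.
  rewrite -(@nceval_conj _ _ _ _ x) // => l.
  by rewrite -[in RHS](flipK l) yNI conj_mxK.
(* d is a common denominator of f^-1 and conj(f)^-1 along the curve, and y2
   lists the numerators of all letters of g over it. *)
pose d := de * conj_poly de.
have dI : d.[I] != 0.
  by rewrite hornerM mulf_neq0 // horner_conj_poly conjI conjc_eq0.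
pose y2 (l : option bool * bool) : 'M[{poly C}]_n.+1 :=
  match l with
  | (Some v, c) => d *: y (v, c)
  | (None, false) => conj_poly de *: \adj M
  | (None, true) => de *: map_mx (@conj_poly R) (\adj M)
  end.
pose D := (\max_(t <- g) size t.2)%N.
have gD : all (fun t => size t.2 <= D)%N g.
  by apply/allP => t tg; rewrite /D (big_rem _ tg) /= leq_maxl.
pose N := \sum_(t <- g) (t.1%:P * d ^+ (D - size t.2)) *: word_val y2 t.2.
pose ka := \det (y (false, true)).
have kaI : ka.[I] != 0.
  by rewrite mxeval_det yI -unitfE -unitmxE.
(* det(X') S, with the inverse of X' replaced by the adjugate. *)
pose H := ka *: y (false, false) + y (true, false) *m \adj (y (false, true))
   *m y (true, true).
have adjE (A : 'M[C]_n.+1) : A \in unitmx -> \adj A = \det A *: invmx A.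
  move=> Au; have dA : \det A != 0 by rewrite -unitfE -unitmxE.
  by rewrite /invmx Au scalerA mulfV // scale1r.
have HE z : mxeval z (y (false, true)) \in unitmx -> mxeval z H =
    ka.[z] *: (mxeval z (y (false, false)) + mxeval z (y (true, false))
       *m invmx (mxeval z (y (false, true))) *m mxeval z (y (true, true))).
  move=> Au; rewrite mxevalD !mxevalM mxevalZ mxeval_adj adjE // mxeval_det.
  by rewrite -scalemxAr -scalemxAl scalerDr.
suff HN : H *m N = (ka * d ^+ D)%:M.
  have := congr1 (mxeval I) HN.
  rewrite mxevalM mxeval_scalar HE ?yI // xsing scaler0 mul0mx.
  move/matrixP/(_ ord0 ord0)/eqP; rewrite !mxE eqxx mulr1n eq_sym.
  rewrite (hornerM ka) horner_exp mulf_eq0 expf_eq0.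
  by rewrite (negPf kaI) (negPf dI) andbF.
apply/matrixP=> i j; apply/eqP; rewrite -subr_eq0; apply/eqP.
apply: (@poly_identity R _ (b * ka)) => [|s].
  rewrite mulf_neq0 //; apply: contraNneq kaI => ->; by rewrite horner0.
rewrite hornerM mulf_eq0 negb_or => /andP[/Ub/UP[]].
set z := s%:C%C; set zz := input_pair _ _; set F := nceval _ _ => Fu Sg kaz.
have y'u : mxeval z (y (false, true)) \in unitmx.
  by rewrite unitmxE -mxeval_det unitfE.
have MF : mxeval z M = F by rewrite ME; apply: eq_nceval => l; apply: yR.
have x2y l : d.[z] *: star (adjoin zz (invmx F)) l = mxeval z (y2 l).
  have dez : de.[z] = \det F by rewrite /de mxeval_det MF.
  have dcz : (conj_poly de).[z] = conjc (\det F).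
    by rewrite horner_conj_poly conjc_realC dez.
  case: l => [[v|] c]; rewrite /y2.
    by rewrite mxevalZ yR; case: c.
  rewrite hornerM dez dcz; case: c; rewrite /star /= mxevalZ.
    rewrite mxeval_conj conjc_realC mxeval_adj MF adjE // conj_mxZ scalerA.
    by rewrite dez.
  by rewrite mxeval_adj MF adjE // scalerA dcz mulrC.
have NE : mxeval z N = d.[z] ^+ D *: nceval (star (adjoin zz (invmx F))) g.
  rewrite (nceval_homogenize x2y gD) mxeval_sum; apply: eq_bigr => t _.
  by rewrite mxevalZ !hornerE mxeval_word.
have : mxeval z (H *m N) = mxeval z (ka * d ^+ D)%:M.
  rewrite mxevalM HE // NE -scalemxAl -scalemxAr scalerA mxeval_scalar.
  rewrite (hornerM ka) horner_exp -scalemx1 !yR; congr (_ *: _).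
  by apply: Sg; have := y'u; rewrite yR.
move/matrixP/(_ i j); rewrite !mxE /horner_eval hornerD hornerN => ->.
by rewrite subrr.
Qed.

End Core.

(** * Straight-line programs as noncommutative polynomials *)

Section Programs.
Variable R : realType.
Local Notation C := R[i].

Section Symbolic.
Variable T : eqType.
Local Notation ncp := (ncpoly C (T * bool)%type).

Definition ncvar (v : T) : ncp := [:: (1, [:: (v, false)])].

(** The value for Inv is a dummy: symbolic execution is applied to
    inversion-free programs. *)
Definition sym_step (s : seq ncp) (c : step C) : ncp :=
  match c with
  | Add p q => nth [::] s p ++ nth [::] s q
  | Defs.Sub p q => nth [::] s p ++ ncscale (-1) (nth [::] s q)
  | Mul p q => ncmul (nth [::] s p) (nth [::] s q)
  | Scale x p => ncscale x (nth [::] s p)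
  | Conj p => ncconj (nth [::] s p)
  | Inv _ => [::]
  end.

Fixpoint sym_exec (s : seq ncp) (cs : seq (step C)) : seq ncp :=
  if cs is c :: cs' then sym_exec (rcons s (sym_step s c)) cs' else s.

Lemma nceval_var n (z : T -> 'M[C]_n) v : nceval (star z) (ncvar v) = z v.
Proof. by rewrite /nceval big_seq1 scale1r /= mulmx1. Qed.

Lemma nceval_one n (x : T * bool -> 'M[C]_n) : nceval x [:: (1, [::])] = 1%:M.
Proof. by rewrite /nceval big_seq1 scale1r. Qed.

Lemma nth_nceval n (x : T * bool -> 'M[C]_n) s p :
  [seq nceval x f | f <- s]`_p = nceval x (nth [::] s p).
Proof.
case: (ltnP p (size s)) => sp; first exact: nth_map.
by rewrite !nth_default ?size_map // /nceval big_nil.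
Qed.

(** The polynomials computed do not depend on the size of the matrices, which
    is what lets [singular_point] choose that size. *)
Lemma exec_symbolic n (z : T -> 'M[C]_n) s cs :
    count (@is_inversion C) cs = 0%N ->
  exec [seq nceval (star z) f | f <- s] cs =
  Some [seq nceval (star z) f | f <- sym_exec s cs].
Proof.
elim: cs s => //= c cs IH s /eqP; rewrite addn_eq0 => /andP[c0 /eqP cs0].
have -> : exec_step [seq nceval (star z) f | f <- s] c =
    Some (nceval (star z) (sym_step s c)).
  case: c c0 => //= [p q|p q|p q|x p|p] _; rewrite !nth_nceval; congr Some.
  - by rewrite nceval_cat.
  - by rewrite nceval_cat nceval_scale scaleN1r.
  - by rewrite nceval_mul.
  - by rewrite nceval_scale.
  - by rewrite (nceval_conj (x := star z)) // => l; apply: star_flip.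
by rewrite -map_rcons IH.
Qed.

End Symbolic.

Definition embed (f : ncpoly C letter) : ncpoly C (option bool * bool)%type :=
  [seq (t.1, [seq (Some l.1, l.2) | l <- t.2]) | t <- f].

Lemma nceval_embed n (z : bool -> 'M[C]_n) U f :
  nceval (star (adjoin z U)) (embed f) = nceval (star z) f.
Proof.
rewrite /nceval big_map; apply: eq_bigr => t _; congr (_ *: _) => /=.
by elim: t.2 => //= -[v c] w ->; case: c.
Qed.

Lemma exec_cat n (s : seq 'M[C]_n) cs1 cs2 :
  exec s (cs1 ++ cs2) = obind (fun r => exec r cs2) (exec s cs1).
Proof. by elim: cs1 s => //= c cs IH s; case: exec_step. Qed.

Lemma generically_imp n (P Q : 'M[C]_n -> 'M[C]_n -> Prop) :
  (forall Z1 Z2, P Z1 Z2 -> Q Z1 Z2) -> generically P -> generically Q.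
Proof. by move=> PQ [V [? ? VP]]; exists V; split=> // Z1 Z2 /VP/PQ. Qed.

(** What the two expressions have in common: the first matrix is the inverse of
    the Schur complement.  Invertibility of Z1 is assumed because it is not part
    of what [quaternion_inverse] asserts. *)
Definition solves_schur (E : expression R) : Prop :=
  forall n (Z1 Z2 : 'M[C]_n) Ws, E n Z1 Z2 Ws ->
    conj_mx Z1 \in unitmx -> schur Z1 Z2 *m Ws`_0 = 1%:M.

Lemma single_inversion_split (cs : seq (step C)) :
    (count (@is_inversion C) cs <= 1)%N ->
  count (@is_inversion C) cs = 0%N \/ exists cs1 p cs2,
    [/\ cs = cs1 ++ Inv p :: cs2, count (@is_inversion C) cs1 = 0%N
      & count (@is_inversion C) cs2 = 0%N].
Proof.
elim: cs => [|c cs IH] /=; first by left.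
case: (boolP (is_inversion c)) => [|nc] /=.
  case: c => // p _; rewrite add1n ltnS leqn0 => /eqP cs0.
  by right; exists [::], p, cs.
rewrite add0n => /IH [-> | [cs1 [p [cs2 [-> cs10 cs20]]]]]; first by left.
by right; exists (c :: cs1), p, cs2; rewrite /= (negPf nc) cs10.
Qed.

Definition input_regs (T : eqType) (u v : T) : seq (ncpoly C (T * bool)%type) :=
  [:: ncvar u; ncvar v; [:: (1, [::])]].

Lemma nceval_input_regs n (T : eqType) (z : T -> 'M[C]_n) u v :
  [seq nceval (star z) f | f <- input_regs u v] = [:: z u; z v; 1%:M].
Proof. by rewrite /= !nceval_var nceval_one. Qed.

Definition first_output (T : eqType) (a : algorithm C)
    (s : seq (ncpoly C (T * bool)%type)) : ncpoly C (T * bool)%type :=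
  nth [::] [seq nth [::] s p | p <- outputs a] 0.

Lemma nceval_first_output n (T : eqType) (x : T * bool -> 'M[C]_n) a s :
  [seq [seq nceval x f | f <- s]`_p | p <- outputs a]`_0 =
  nceval x (first_output a s).
Proof.
rewrite -nth_nceval -map_comp; congr (_`_0); apply: eq_map => p /=.
exact: nth_nceval.
Qed.

(** The polynomial f of [no_single_inversion] is the operand of the inversion,
    or 1 for a program without inversion. *)
Lemma inversions_ge2 (E : expression R) (a : algorithm C) :
  solves_schur E -> computes a E -> (2 <= inversions a)%N.
Proof.
move=> solE compE; rewrite ltnNge; apply/negP => /single_inversion_split.
case=> [inv0 | [cs1 [p [cs2 [stepsE inv1 inv2]]]]].
  pose s := sym_exec (input_regs (Some false) (Some true)) (steps a).
  apply: (@no_single_inversion R [:: (1, [::])] (first_output a s)) => n n0.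
  apply: generically_imp (compE n n0) => Z1 Z2 [Ws runE EWs] F.
  have F1 : F = 1%:M by apply: nceval_one.
  split=> [|cu]; first by rewrite F1 unitmx1.
  rewrite -(solE _ _ _ _ EWs cu); congr (_ *m _); move: runE.
  rewrite /run -[[:: Z1; Z2; _]](nceval_input_regs
    (adjoin (input_pair Z1 Z2) (invmx F)) (Some false) (Some true)).
  by rewrite exec_symbolic // => -[<-]; rewrite nceval_first_output.
pose s1 := sym_exec (input_regs false true) cs1.
pose f := nth [::] s1 p.
pose s2 := sym_exec (rcons [seq embed g | g <- s1] (ncvar None)) cs2.
apply: (@no_single_inversion R f (first_output a s2)) => n n0.
apply: generically_imp (compE n n0) => Z1 Z2 [Ws runE EWs] F.
move: runE; rewrite /run stepsE exec_cat.
rewrite -[[:: Z1; Z2; _]](nceval_input_regs (input_pair Z1 Z2) false true).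
rewrite exec_symbolic //= nth_nceval -/f -/F.
case: ifP => // Fu runE; split=> // cu.
rewrite -(solE _ _ _ _ EWs cu); congr (_ *m _); move: runE.
have -> : rcons [seq nceval (star (input_pair Z1 Z2)) f0 | f0 <- s1] (invmx F) =
    [seq nceval (star (adjoin (input_pair Z1 Z2) (invmx F))) g |
      g <- rcons [seq embed g | g <- s1] (ncvar None)].
  rewrite map_rcons nceval_var -map_comp; congr rcons.
  by apply: eq_map => g /=; rewrite nceval_embed.
by rewrite exec_symbolic //= => -[<-]; rewrite nceval_first_output.
Qed.

End Programs.

(** * Programs without additions *)

Section Monomials.
Variable R : realType.
Local Notation C := R[i].

Definition monomial_val n (t : R) (m : int * 'M[C]_n) : 'M[C]_n :=
  (t%:C%C ^ m.1) *: m.2.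

Lemma nth_monomial_val n (t : R) (s : seq (int * 'M[C]_n)) p :
  [seq monomial_val t m | m <- s]`_p = monomial_val t (nth (0, 0) s p).
Proof.
case: (ltnP p (size s)) => sp; first exact: nth_map.
by rewrite !nth_default ?size_map // /monomial_val scaler0.
Qed.

Lemma realC_neq0 (t : R) : t != 0 -> t%:C%C != 0 :> C.
Proof. by move=> t0; rewrite fmorph_eq0. Qed.

Lemma conjc_realCX (t : R) (k : int) : conjc (t%:C%C ^ k) = t%:C%C ^ k.
Proof. 
rewrite fmorphXz.
exact: (congr1 (fun z => z ^ k) (conjc_realC t)).
Qed.

(** Success at one t0 is needed to know that every inverted matrix is
    invertible; this then holds for all nonzero t, as scaling does not affect it. *)
Lemma exec_monomial n (s : seq (int * 'M[C]_n)) cs t0 r :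
    count (@is_addition C) cs = 0%N -> t0 != 0 ->
    exec [seq monomial_val t0 m | m <- s] cs = Some r ->
  exists s', forall t, t != 0 ->
    exec [seq monomial_val t m | m <- s] cs =
    Some [seq monomial_val t m | m <- s'].
Proof.
move=> + t00; elim: cs s => [|c cs IH] s /= => [_ _|]; first by exists s.
move/eqP; rewrite addn_eq0 => /andP[c0 /eqP cs0].
have nthE t p := nth_monomial_val t s p.
move=> ex; have [X [Ec execX]] : exists X,
    exec_step [seq monomial_val t0 m | m <- s] c = Some X /\
    exec (rcons [seq monomial_val t0 m | m <- s] X) cs = Some r.
  by move: ex; case: exec_step => // X execX; exists X.
clear ex.
have [m mE] : exists m, forall t, t != 0 ->
    exec_step [seq monomial_val t m | m <- s] c = Some (monomial_val t m).
  move: c0 Ec; case: c => [p q|p q|p q|x p|p|p] c0;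
    [discriminate c0|discriminate c0| | | |]; clear c0; rewrite /=.
  - move=> _; set m1 := nth (0, 0) s p; set m2 := nth (0, 0) s q.
    exists (m1.1 + m2.1, m1.2 *m m2.2) => t /realC_neq0 tn.
    rewrite (nthE t p) (nthE t q) /monomial_val expfzDr //.
    by rewrite -scalemxAl -scalemxAr scalerA.
  - move=> _; set m1 := nth (0, 0) s p; exists (m1.1, x *: m1.2) => t _.
    by rewrite (nthE t p) /monomial_val !scalerA mulrC.
  - move=> _; set m1 := nth (0, 0) s p.
    exists (m1.1, conj_mx m1.2) => t /realC_neq0 tn.
    by rewrite (nthE t p) /monomial_val conj_mxZ conjc_realCX.
  - move=> Ec; set m1 := nth (0, 0) s p.
    have u0 : monomial_val t0 m1 \in unitmx.
      by move: Ec; rewrite (nthE t0 p); case: ifP.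
    exists (- m1.1, invmx m1.2) => t tn.
    have unitE t' : t' != 0 ->
        (monomial_val t' m1 \in unitmx) = (m1.2 \in unitmx).
      by move=> /realC_neq0 t'0; rewrite unitmxZ // unitfE expfz_neq0.
    have m1u : m1.2 \in unitmx by rewrite -(unitE t0).
    have tmu : monomial_val t m1 \in unitmx by rewrite unitE.
    rewrite (nthE t p) tmu; congr Some.
    by rewrite /monomial_val (invmxZ tmu) -invr_expz.
have EX : X = monomial_val t0 m by have := mE _ t00; rewrite Ec => -[].
rewrite EX -map_rcons in execX.
have [s' hs'] := IH _ cs0 execX; exists s' => t tn.
by rewrite (mE t tn) -map_rcons (hs' t tn).
Qed.

(** Multiplied by conj(z1), the relation says that (al + be t^2) t^k a is a
    nonzero constant, where al = |z1|^2 and be = |z2|^2.  For k >= 0 it is a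
    polynomial with the term be a t^(k+2); for k < 0 multiplication by t^-k
    yields a polynomial with constant term al a.  Either way a = 0. *)
Lemma monomial_schur_neq (z1 z2 a : C) (k : int) (b : {poly C}) :
    z1 != 0 -> z2 != 0 -> b != 0 ->
  ~ (forall t : R, t != 0 -> b.[t%:C%C] != 0 ->
       (z1 + t%:C%C * z2 / conjc z1 * conjc (t%:C%C * z2)) *
       (t%:C%C ^ k * a) = 1).
Proof.
move=> z10 z20 b0 H.
have c10 : conjc z1 != 0 by rewrite conjc_eq0.
pose al := z1 * conjc z1; pose be := z2 * conjc z2.
have al0 : al != 0 by rewrite mulf_neq0.
have be0 : be != 0 by rewrite mulf_neq0 ?conjc_eq0.
have E (t : R) : t != 0 -> b.[t%:C%C] != 0 ->
    (al + be * t%:C%C ^+ 2) * (t%:C%C ^ k * a) = conjc z1.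
  move=> t0 bt; have cM : conjc (t%:C%C * z2) = t%:C%C * conjc z2.
    by rewrite rmorphM; exact: (congr1 (fun z => z * _) (conjc_realC t)).
  rewrite -[RHS]mul1r -(H t t0 bt) cM /al /be.
  move: (t%:C%C ^ k) (conjc z1) c10 (conjc z2) (t%:C%C) => tk w1 w10 w2 tc.
  by field.
clearbody al be.
have bX : b * 'X != 0 by rewrite mulf_neq0 ?polyX_eq0.
have vanish p :
    (forall t : R, t != 0 -> b.[t%:C%C] != 0 -> p.[t%:C%C] = 0) -> p = 0.
  move=> hp; apply: (poly_identity bX) => t; rewrite hornerM hornerX mulf_eq0.
  rewrite negb_or => /andP[bt tn]; apply: hp => //.
  by rewrite -(fmorph_eq0 (real_complex R)).
case: k H E => m _ E.
  pose p := (a * al) *: 'X^m + (a * be) *: 'X^(m + 2) - (conjc z1)%:P.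
  have p0 : p = 0.
    apply: vanish => t tn bt.
    rewrite !(hornerD, hornerN, hornerZ, hornerXn, hornerC).
    rewrite exprD -(E t tn bt) -exprnP.
    by ring.
  have := congr1 (fun q : {poly C} => q`_(m + 2)) p0.
  rewrite coef0 coefB coefD !coefZ !coefXn eqxx coefC addnS /=.
  rewrite addn1 gtn_eqF ?leqnSn // mulr0 add0r mulr1 subr0 => /eqP.
  rewrite mulf_eq0 (negPf be0) orbF => /eqP a0; move: p0.
  rewrite /p a0 !mul0r !scale0r !add0r => /eqP.
  by rewrite oppr_eq0 polyC_eq0 (negPf c10).
pose p := (a * al)%:P + (a * be) *: 'X^2 - (conjc z1) *: 'X^(m.+1).
have p0 : p = 0.
  apply: vanish => t tn bt.
  rewrite !(hornerD, hornerN, hornerZ, hornerXn, hornerC).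
  rewrite -(E t tn bt) NegzE.
  rewrite -exprnN; have := expf_neq0 m.+1 (realC_neq0 tn).
  rewrite expr2; move: (_ ^+ m.+1) => v v0.
  by field.
have := congr1 (fun q : {poly C} => q`_0) p0.
rewrite coef0 coefB coefD !coefZ !coefXn coefC !mulr0 addr0 subr0 => /eqP.
rewrite mulf_eq0 (negPf al0) orbF => /eqP a0; move: p0.
rewrite /p a0 !mul0r scale0r !add0r => /eqP.
by rewrite oppr_eq0 scaler_eq0 (negPf c10) -size_poly_eq0 size_polyXn.
Qed.

(** A generic point is first moved to one with nonzero entries z1, z2; from
    there Z2 is scaled by real t. *)
Lemma additions_ge1 (E : expression R) (a : algorithm C) :
  solves_schur E -> computes a E -> (1 <= additions a)%N.
Proof.
move=> solE compE; rewrite ltnNge leqn0; apply/negP => /eqP add0.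
have [U [[Z1 [Z2 UZ]] UP Ucurve]] := generically_curve (compE 1%N isT).
have ev0 (G : 'M[C]_1) (z : C) (H : 'M[{poly C}]_1) :
    mxeval z (map_mx polyC G + 'X *: H) = G + z *: mxeval z H.
  by apply/matrixP=> i j; rewrite !mxE /horner_eval !hornerE.
have evc (G : 'M[C]_1) z : mxeval z (map_mx polyC G) = G.
  by apply/matrixP=> i j; rewrite !mxE /horner_eval hornerC.
(* The line from Z to 1: its generic points have a nonzero entry. *)
pose G (Z : 'M[C]_1) := map_mx polyC Z + 'X *: map_mx polyC (1%:M - Z).
have GE Z z : mxeval z (G Z) = Z + z *: (1%:M - Z) by rewrite ev0 evc.
have [|b b0 hb] := Ucurve (G Z1) (G Z2) 0; first by rewrite !GE !scale0r !addr0.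
have G1 Z : (G Z 0 0) != 0.
  apply/eqP=> G0; have /matrixP/(_ 0 0) := GE Z 1.
  rewrite mxE G0 /horner_eval horner0 scale1r addrC subrK mxE => /eqP.
  by rewrite eq_sym oner_eq0.
have [|k] := @poly_nonroot _ (b * (G Z1 0 0 * G Z2 0 0)).
  by rewrite !mulf_neq0.
rewrite !hornerM !mulf_eq0 !negb_or -realC_nat => /and3P[/hb + nz1 nz2].
set Y1 := mxeval _ _; set Y2 := mxeval _ _ => UY.
have z10 : Y1 0 0 != 0 by rewrite mxE.
have z20 : Y2 0 0 != 0 by rewrite mxE.
clearbody Y1 Y2.
have [|c c0 hc] := Ucurve (map_mx polyC Y1) ('X *: map_mx polyC Y2) 1.
  by rewrite mxevalZ hornerX !evc scale1r.
have {}hc t : c.[t%:C%C] != 0 -> exists2 Ws, run a Y1 (t%:C%C *: Y2) = Some Ws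
    & E 1%N Y1 (t%:C%C *: Y2) Ws.
  by move/hc/UP; rewrite mxevalZ hornerX !evc.
pose s0 := [:: (0, Y1); (1, Y2); (0, 1%:M)] : seq (int * 'M[C]_1).
have s0E t : [:: Y1; t%:C%C *: Y2; 1%:M] = [seq monomial_val t m | m <- s0].
  by rewrite /= /monomial_val expr0z expr1z !scale1r.
have [t1 [t10 ct1]] : exists t : R, t != 0 /\ c.[t%:C%C] != 0.
  have [|m] := @poly_nonroot _ (c * 'X); first by rewrite mulf_neq0 ?polyX_eq0.
  rewrite hornerM hornerX mulf_eq0 negb_or -realC_nat => /andP[cm m0].
  by exists m%:R; rewrite -(fmorph_eq0 (real_complex R)).
have [Ws1 + _] := hc _ ct1; rewrite /run s0E.
case E1: exec => [r|] // _.
have [s' hs'] := exec_monomial add0 t10 E1.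
pose m := nth (0, 0) [seq nth (0, 0) s' p | p <- outputs a] 0.
apply: (@monomial_schur_neq (Y1 0 0) (Y2 0 0) (m.2 0 0) m.1 c) => //.
move=> t tn /hc[Ws].
rewrite /run s0E hs' //= => -[<-] EWs.
have Y1u : conj_mx Y1 \in unitmx.
  by rewrite conj_mx_unit unitmxE det_mx11 unitfE.
have := solE _ _ _ _ EWs Y1u.
have -> : [seq [seq monomial_val t m | m <- s']`_p | p <- outputs a]`_0 =
    monomial_val t m.
  rewrite -nth_monomial_val -map_comp; congr (_`_0); apply: eq_map => p /=.
  exact: nth_monomial_val.
have mul11 (A B : 'M[C]_1) : (A *m B) 0 0 = A 0 0 * B 0 0.
  by rewrite mxE big_ord1.
have inv11 (A : 'M[C]_1) : A \in unitmx -> (invmx A) 0 0 = (A 0 0)^-1.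
  move=> Au; have := congr1 (fun B : 'M[C]_1 => B 0 0) (mulmxV Au).
  rewrite mul11 mxE => AV; apply: (mulfI (x := A 0 0)).
    by move: Au; rewrite unitmxE det_mx11 unitfE.
  rewrite AV mulfV //; by move: Au; rewrite unitmxE det_mx11 unitfE.
move/matrixP/(_ 0 0); rewrite mul11 mxE !mul11 inv11 // !mxE => ->.
by rewrite eqxx.
Qed.

End Monomials.

(** * Quaternion matrices as pairs of complex matrices *)

Section Quaternions.
Variable R : realType.
Local Notation C := R[i].

Definition quat_of_pair (p q : C) : quaternion R :=
  Quat (complex.Re p) (complex.Im p) (complex.Re q) (- complex.Im q).

Lemma quat_of_pairD p q p' q' :
  quat_of_pair (p + p') (q + q') = quat_of_pair p q + quat_of_pair p' q'.
Proof.
by case: p q p' q' => ? ? [? ?] [? ?] [? ?]; congr Quat; rewrite /= ?opprD.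
Qed.

Lemma quat_pairE n (P Q : 'M[C]_n) i j :
  quat_pair P Q i j = quat_of_pair (P i j) (Q i j).
Proof. by rewrite !mxE; congr Quat; rewrite /=; ring. Qed.

Lemma quat_pair_inj n (P Q P' Q' : 'M[C]_n) :
  quat_pair P Q = quat_pair P' Q' -> P = P' /\ Q = Q'.
Proof.
move=> eqPQ; split; apply/matrixP=> i j; have /matrixP/(_ i j) := eqPQ;
  rewrite !quat_pairE;
  case: (P i j) (Q i j) (P' i j) (Q' i j) => ? ? [? ?] [? ?] [? ?].
  by case=> -> ->.
by case=> _ _ -> /oppr_inj ->.
Qed.

Lemma quat_pair1 n : quat_pair (1%:M : 'M[C]_n) 0 = 1%:M.
Proof.
apply/matrixP=> i j; rewrite quat_pairE !mxE.
by case: (i == j); congr Quat; rewrite /= ?oppr0.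
Qed.

Lemma quat_pair_surj n (W : 'M[quaternion R]_n) :
  exists P Q : 'M[C]_n, W = quat_pair P Q.
Proof. by have [Z1 [Z2 ->]] := quat_mx_surj W; exists Z1, (conj_mx Z2). Qed.

(** This is j X = conj(X) j together with j^2 = -1. *)
Lemma quat_pairM n (P Q P' Q' : 'M[C]_n) :
  quat_pair P Q *m quat_pair P' Q' =
  quat_pair (P *m P' - conj_mx Q *m Q') (conj_mx P *m Q' + Q *m P').
Proof.
apply/matrixP=> i j; rewrite quat_pairE !mxE -sumrB -big_split /=.
have -> : \sum_k quat_pair P Q i k * quat_pair P' Q' k j =
  \sum_k quat_of_pair (P i k * P' k j - conj_mx Q i k * Q' k j)
                     (conj_mx P i k * Q' k j + Q i k * P' k j).
  apply: eq_bigr => k _; rewrite !quat_pairE !mxE.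
  case: (P i k) (Q i k) (P' k j) (Q' k j) => p1 p2 [q1 q2] [r1 r2] [s1 s2].
  by congr Quat; rewrite /=; ring.
elim/big_rec3: _ => [|k p q r _ ->]; first by congr Quat; rewrite /= oppr0.
by rewrite -quat_of_pairD.
Qed.

Lemma quat_inverseP n (Z1 Z2 P Q : 'M[C]_n) :
  is_inverse (quat_mx Z1 Z2) (quat_pair P Q) ->
  Z1 *m P - Z2 *m Q = 1%:M /\ conj_mx Z1 *m Q + conj_mx Z2 *m P = 0.
Proof.
case=> + _; rewrite /quat_mx quat_pairM conj_mxK -quat_pair1.
exact: quat_pair_inj.
Qed.

(** The matrix of left multiplication by P + jQ on H^n, viewed as a right
    complex vector space with its decomposition C^n + j C^n. *)
Definition complex_rep n (P Q : 'M[C]_n) : 'M[C]_(n + n) :=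
  block_mx P (- conj_mx Q) Q (conj_mx P).

Lemma complex_repM n (P Q P' Q' : 'M[C]_n) :
  complex_rep P Q *m complex_rep P' Q' =
  complex_rep (P *m P' - conj_mx Q *m Q') (conj_mx P *m Q' + Q *m P').
Proof.
rewrite /complex_rep mulmx_block /conj_mx map_mxB map_mxD !map_mxM -/conj_mx.
rewrite -![map_mx _ _]/(conj_mx _) !conj_mxK !mulNmx !mulmxN opprD.
by congr block_mx; rewrite addrC.
Qed.

Lemma complex_rep1 n : complex_rep (1%:M : 'M[C]_n) 0 = 1%:M.
Proof.
by rewrite /complex_rep /conj_mx map_mx1 map_mx0 oppr0 -scalar_mx_block.
Qed.

(** A one-sided inverse P' + jQ' is read off the first block column of the
    complex inverse; it is two-sided because complex matrices are Dedekind
    finite and the representation is faithful. *)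
Lemma quat_invertible_rep n (P Q : 'M[C]_n) :
  complex_rep P Q \in unitmx -> quat_invertible (quat_pair P Q).
Proof.
move=> Lu; set L := complex_rep P Q in Lu.
pose P' := usubmx (lsubmx (invmx L)); pose Q' := dsubmx (lsubmx (invmx L)).
have colL : L *m col_mx P' Q' = col_mx 1%:M 0.
  have -> : col_mx P' Q' = lsubmx (invmx L) by exact: vsubmxK.
  have -> : lsubmx (invmx L) = invmx L *m col_mx 1%:M 0.
    rewrite -[invmx L in RHS]hsubmxK mul_row_col mulmx1 mulmx0 addr0.
    by [].
  by rewrite mulmxA mulmxV // mul1mx.
have [e1 e2] : P *m P' - conj_mx Q *m Q' = 1%:M /\
    conj_mx P *m Q' + Q *m P' = 0.
  move: colL; rewrite mul_block_col mulNmx => /eq_col_mx[-> <-].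
  by rewrite addrC.
have LL' : L *m complex_rep P' Q' = 1%:M.
  by rewrite complex_repM e1 e2 complex_rep1.
exists (quat_pair P' Q'); split; first by rewrite quat_pairM e1 e2 quat_pair1.
have := mulmx1C LL'; rewrite complex_repM -complex_rep1 quat_pairM.
by case/eq_block_mx => -> _ -> _; rewrite quat_pair1.
Qed.

(** The inverse P + jQ, known to exist, is determined by the two equations of
    [quat_inverseP]: eliminating Q (or P) shows that the matrix inverted last is
    invertible, with inverse P (or - Q). *)
Lemma frobenius_correct n (Z1 Z2 : 'M[C]_n) (a : algorithm C) :
    quat_invertible (quat_mx Z1 Z2) -> frobenius Z1 Z2 = Some a ->
  inversions a = 2%N /\
  exists P Q : 'M[C]_n,
    run a Z1 Z2 = Some [:: P; Q] /\ is_inverse (quat_mx Z1 Z2) (quat_pair P Q).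
Proof.
case=> W; have [P [Q ->]] := quat_pair_surj W => invW.
have [e1 e2] := quat_inverseP invW; rewrite /frobenius.
have inv_of (S X : 'M[C]_n) : S *m X = 1%:M -> S \in unitmx /\ invmx S = X.
  move=> SX; have [Su _] := mulmx1_unit SX; split=> //.
  by rewrite -[invmx S]mulmx1 -SX mulmxA mulVmx // mul1mx.
case: ifP => [Z1u [<-] | _].
  split=> //; exists P, Q; split=> //.
  have cu : conj_mx Z1 \in unitmx by rewrite conj_mx_unit.
  have QE : Q = - (invmx (conj_mx Z1) *m conj_mx Z2 *m P).
    move/eqP: e2; rewrite addr_eq0 => /eqP e2.
    by rewrite -[Q](mulKmx cu) e2 mulmxN mulmxA.
  have /inv_of[Su SE] :
      (Z1 + Z2 *m (invmx (conj_mx Z1) *m conj_mx Z2)) *m P = 1%:M.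
    by rewrite -e1 QE mulmxN opprK mulmxDl !mulmxA.
  by rewrite /run /= cu /= Su /= SE scaleN1r -QE.
case: ifP => [Z2u [<-] | //].
split=> //; exists P, Q; split=> //.
have cu : conj_mx Z2 \in unitmx by rewrite conj_mx_unit.
have PE : P = - (invmx (conj_mx Z2) *m conj_mx Z1 *m Q).
  move/eqP: e2; rewrite addrC addr_eq0 => /eqP e2.
  by rewrite -[P](mulKmx cu) e2 mulmxN mulmxA.
have /inv_of[Su SE] :
    (Z1 *m (invmx (conj_mx Z2) *m conj_mx Z1) + Z2) *m (- Q) = 1%:M.
  by rewrite -e1 PE !mulmxN mulmxDl opprD !mulmxA.
by rewrite /run /= cu /= Su /= SE mulmxN -PE scaleN1r opprK.
Qed.

Lemma quaternion_inverse_solves : solves_schur (@quaternion_inverse R).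
Proof.
move=> n Z1 Z2 _ [P [Q [-> /quat_inverseP[e1 e2]]]] cu /=.
move/eqP: e2; rewrite addr_eq0 => /eqP e2.
rewrite -e1 mulmxDl -!mulmxA -[Q](mulKmx cu) e2.
by rewrite !mulmxN opprK.
Qed.

Lemma inverse_schur_solves : solves_schur (@inverse_schur R).
Proof. by move=> n Z1 Z2 _ [_ Su ->] _ /=; rewrite mulmxV. Qed.

(** * Polynomial conditions on the real coordinates *)

(** These functions form a ring stable under conjugation, so determinants of
    matrices built from Z1, Z2 and their conjugates belong to it. *)
Definition polyfun n (g : 'M[C]_n -> 'M[C]_n -> C) : Prop :=
  exists p : {mpoly R[(n * n + n * n) + (n * n + n * n)]} *
             {mpoly R[(n * n + n * n) + (n * n + n * n)]},
    forall Z1 Z2, complex.Re (g Z1 Z2) = p.1.@[real_coords Z1 Z2 0] /\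
                  complex.Im (g Z1 Z2) = p.2.@[real_coords Z1 Z2 0].

Section PolynomialFunctions.
Variable n : nat.
Implicit Types g h : 'M[C]_n -> 'M[C]_n -> C.

Lemma polyfun_const c : polyfun (fun _ _ : 'M[C]_n => c).
Proof.
by exists ((complex.Re c)%:MP, (complex.Im c)%:MP) => Z1 Z2 /=; rewrite !mevalC.
Qed.

Lemma polyfun_ext g h : (forall Z1 Z2, h Z1 Z2 = g Z1 Z2) ->
  polyfun g -> polyfun h.
Proof. by move=> hg [p gE]; exists p => Z1 Z2; rewrite hg. Qed.

Lemma polyfun_add g h : polyfun g -> polyfun h ->
  polyfun (fun Z1 Z2 => g Z1 Z2 + h Z1 Z2).
Proof.
move=> [[p q] gE] [[p' q'] hE]; exists (p + p', q + q') => Z1 Z2 /=.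
rewrite !mevalD; have /= [<- <-] := gE Z1 Z2; have /= [<- <-] := hE Z1 Z2.
by case: (g Z1 Z2) (h Z1 Z2) => a b [c d].
Qed.

Lemma polyfun_mul g h : polyfun g -> polyfun h ->
  polyfun (fun Z1 Z2 => g Z1 Z2 * h Z1 Z2).
Proof.
move=> [[p q] gE] [[p' q'] hE].
exists (p * p' - q * q', p * q' + q * p') => Z1 Z2 /=.
rewrite mevalB mevalD !mevalM.
have /= [<- <-] := gE Z1 Z2; have /= [<- <-] := hE Z1 Z2.
by case: (g Z1 Z2) (h Z1 Z2) => a b [c d].
Qed.

Lemma polyfun_big (op : C -> C -> C) c0 (T : Type) (r : seq T) (F : T -> _) :
    (forall g h, polyfun g -> polyfun h ->
       polyfun (fun Z1 Z2 => op (g Z1 Z2) (h Z1 Z2))) ->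
    (forall t, polyfun (F t)) ->
  polyfun (fun Z1 Z2 : 'M[C]_n => \big[op/c0]_(t <- r) F t Z1 Z2).
Proof.
move=> opP FP; elim: r => [|t r [p IH]].
  have [p hp] := polyfun_const c0; exists p => Z1 Z2.
  by rewrite big_nil; apply: hp.
have [q hq] := opP _ _ (FP t) (ex_intro _ p IH).
by exists q => Z1 Z2; rewrite big_cons; apply: hq.
Qed.

Lemma polyfun_det m (A : 'M[C]_n -> 'M[C]_n -> 'M[C]_m) :
  (forall i j, polyfun (fun Z1 Z2 => A Z1 Z2 i j)) ->
  polyfun (fun Z1 Z2 => \det (A Z1 Z2)).
Proof.
move=> AP; apply: polyfun_big => [|s]; first exact: polyfun_add.
apply: polyfun_mul; first exact: polyfun_const.
by apply: polyfun_big; first exact: polyfun_mul.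
Qed.

Lemma polyfun_conj g : polyfun g -> polyfun (fun Z1 Z2 => conjc (g Z1 Z2)).
Proof.
move=> [[p q] gE]; exists (p, - q) => Z1 Z2 /=; rewrite mevalN.
by have /= [<- <-] := gE Z1 Z2; case: (g Z1 Z2).
Qed.

Lemma polyfun_entry i j :
  polyfun (fun Z1 _ : 'M[C]_n => Z1 i j) /\
  polyfun (fun _ Z2 : 'M[C]_n => Z2 i j).
Proof.
split.
  exists ('X_(lshift _ (lshift _ (mxvec_index i j))),
          'X_(lshift _ (rshift _ (mxvec_index i j)))) => Z1 Z2 /=.
  by rewrite !mevalXU /real_coords !(row_mxEl, row_mxEr) !mxvecE !mxE.
exists ('X_(rshift _ (lshift _ (mxvec_index i j))),
        'X_(rshift _ (rshift _ (mxvec_index i j)))) => Z1 Z2 /=.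
by rewrite !mevalXU /real_coords !(row_mxEl, row_mxEr) !mxvecE !mxE.
Qed.

Lemma polyfun_generically g Z1 Z2 : polyfun g -> g Z1 Z2 != 0 ->
  generically (fun Y1 Y2 : 'M[C]_n => g Y1 Y2 != 0).
Proof.
move=> [[p q] gE] nz; exists (fun Y1 Y2 => g Y1 Y2 = 0); split.
- exists (fun r => r = p \/ r = q) => Y1 Y2; have /= [re im] := gE Y1 Y2; split.
    by move=> g0 r [] ->; rewrite -?re -?im g0.
  move=> h; apply/eqP; rewrite eq_complex re im.
  by rewrite (h p (or_introl erefl)) (h q (or_intror erefl)) !eqxx.
- by exists Z1, Z2; apply/eqP.
- by move=> Y1 Y2 /eqP.
Qed.

End PolynomialFunctions.

Lemma frobenius1_computes : computes (frobenius1 R) (@quaternion_inverse R).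
Proof.
move=> n n0.
pose L (Z1 Z2 : 'M[C]_n) := complex_rep Z1 (conj_mx Z2).
apply: (@generically_imp R n (fun Z1 Z2 => \det Z1 * \det (L Z1 Z2) != 0)).
  move=> Z1 Z2; rewrite mulf_eq0 negb_or -!unitfE -!unitmxE => /andP[Z1u Lu].
  have [|_ [P [Q [runE invPQ]]]] := frobenius_correct (quat_invertible_rep Lu)
    (a := frobenius1 R); first by rewrite /frobenius Z1u.
  by exists [:: P; Q] => //; exists P, Q.
apply: (@polyfun_generically _ _ 1%:M 0); last first.
  by rewrite /L /conj_mx map_mx0 complex_rep1 !det1 mulr1 oner_neq0.
apply: polyfun_mul; apply: polyfun_det => i j.
  exact: (polyfun_entry i j).1.
rewrite /L /complex_rep; case: (split_ordP i) => i' ->;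
  case: (split_ordP j) => j' ->.
- apply: polyfun_ext (polyfun_entry i' j').1 => Z1 Z2.
  by rewrite block_mxEul.
- apply: polyfun_ext
    (polyfun_mul (polyfun_const _ (-1)) (polyfun_entry i' j').2).
  by move=> Z1 Z2; rewrite block_mxEur conj_mxK mxE mulN1r.
- apply: polyfun_ext (polyfun_conj (polyfun_entry i' j').2) => Z1 Z2.
  by rewrite block_mxEdl mxE.
- apply: polyfun_ext (polyfun_conj (polyfun_entry i' j').1) => Z1 Z2.
  by rewrite block_mxEdr mxE.
Qed.

End Quaternions.

Theorem theorem4p4 (R : realType) :
  (forall a : algorithm R[i], computes a (@inverse_schur R) ->
     (1 <= additions a)%N /\ (2 <= inversions a)%N) /\
  (forall (n : nat) (Z1 Z2 : 'M[R[i]]_n), (0 < n)%N ->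
     quat_invertible (quat_mx Z1 Z2) ->
     forall a : algorithm R[i], frobenius Z1 Z2 = Some a ->
       inversions a = 2%N /\
       exists P Q : 'M[R[i]]_n,
         run a Z1 Z2 = Some [:: P; Q] /\
         is_inverse (quat_mx Z1 Z2) (quat_pair P Q)) /\
  (computes (frobenius1 R) (@quaternion_inverse R) /\
   inversions (frobenius1 R) = 2%N) /\
  (forall a : algorithm R[i], computes a (@quaternion_inverse R) ->
     (2 <= inversions a)%N).
Proof.
split; [|split; [|split; [split|]]].
- move=> a ca; split.
    exact: additions_ge1 (@inverse_schur_solves R) ca.
  exact: inversions_ge2 (@inverse_schur_solves R) ca.
- by move=> n Z1 Z2 _ inv a; apply: frobenius_correct inv.
- exact: frobenius1_computes.
- by [].
- by move=> a; apply: inversions_ge2 (@quaternion_inverse_solves R).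
Qed.
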